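(* Suppose the spin system has SSM. Then there is a constant $c>0$ (depending on the spin system and the SSM constants, but not on $V$, $\psi$ or the blocks) such that for every $d$-dimensional cube $V\subset\mathbb{Z}^d$, every boundary condition $\psi$ on $\partial V$, and every collection $\mathcal{A}=\{A_1,\dots,A_r\}$ of subsets of $V$ with $\bigcup_iA_i=V$, the heat-bath block dynamics $\mathcal{B}_\mathcal{A}$ satisfies $\lambda(\mathcal{B}_\mathcal{A})\ge c/r$; i.e., its relaxation time is $O(r)$.
   Context: Fix $d\ge1$; $\mathbb{Z}^d$ has edges between $u,v$ with $\|u-v\|_1=1$; for finite $V$, $G=(V,E)$ is the induced subgraph and $\partial V$ the set of outside vertices adjacent to $V$. A spin system: spins $S=\{1,\dots,q\}$, symmetric edge potential $U:S\times S\to\mathbb{R}\cup\{-\infty\}$, vertex potential $W:S\to\mathbb{R}$; boundary condition $\psi:A^\psi\to S$, $A^\psi\subseteq\partial V$; Gibbs distribution $\mu^\psi(\sigma)\propto\exp\big(\sum_{(u,v)\in E}U(\sigma(u),\sigma(v))+\sum_{u\in A^\psi,v\in V,u\sim v}U(\psi(u),\sigma(v))+\sum_{u\in V}W(\sigma(u))\big)$. The system is permissive and the single-site heat-bath Glauber dynamics is assumed irreducible on the set $\Omega$ of valid configurations. SSM: there exist $a,b>0$ such that for every $d$-dimensional cube $\Lambda$, all $B\subseteq\Lambda$, all $u\in\partial\Lambda$ and all boundary conditions $\psi,\psi_u$ on $\partial\Lambda$ differing only at $u$, $\|\mu^\psi_B-\mu^{\psi_u}_B\|_{TV}\le b\,e^{-a\,\mathrm{dist}(u,B)}$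 ($\mu_B$ the marginal on $B$, $\mathrm{dist}$ the minimal $\ell_1$ distance). Heat-bath block dynamics $\mathcal{B}_\mathcal{A}$: from $\sigma_t$, pick $i$ uniformly from $\{1,\dots,r\}$ and replace $\sigma_t(A_i)$ by a sample from $\mu^\psi(\cdot\mid\sigma_t(V\setminus A_i))$. For $P$ reversible w.r.t. $\mu$ with eigenvalues $1=\lambda_1\ge\dots\ge\lambda_N$, $\lambda(P)=1-\max\{|\lambda_2|,|\lambda_N|\}$. *)

(* Defs.v *)
From HB Require Import structures.
From mathcomp Require Import all_boot all_order all_algebra.
Set Implicit Arguments. Unset Strict Implicit. Unset Printing Implicit Defensive.
Import Order.TTheory GRing.Theory Num.Theory.
Local Open Scope ring_scope.

Definition site (d : nat) := {ffun 'I_d -> int}.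

Definition l1dist d (u v : site d) : nat := (\sum_(i < d) absz (u i - v i))%N.
Definition adjacent d (u v : site d) : bool := l1dist u v == 1%N.

Definition nbr d (u : site d) (i : 'I_d) (b : bool) : site d :=
  [ffun j => if j == i then u j + (if b then 1 else -1) else u j].

(* A finite region V of Z^d is given by a finite type T and a position map
   pos : T -> site d (assumed injective where relevant); V = image of pos. *)
Definition in_region d (T : finType) (pos : T -> site d) (u : site d) : bool :=
  [exists v, pos v == u].
Definition boundary d (T : finType) (pos : T -> site d) (u : site d) : bool :=
  ~~ in_region pos u && [exists v, adjacent u (pos v)].

Definition cube (d L : nat) := {ffun 'I_d -> 'I_L}.
Definition cube_pos d L (a : site d) (v : cube d L) : site d :=
  [ffun i => a i + ((v i : nat)%:Z)].

(* l1 distance from a site u to (the image of) a set B of the region;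
   (an arbitrary value 0 is used when B is empty, where it is irrelevant). *)
Definition dist_set d (T : finType) (pos : T -> site d) (u : site d) (B : {set T}) : nat :=
  if [pick v in B] is Some v0 then
    \big[minn/l1dist u (pos v0)]_(v in B) l1dist u (pos v)
  else 0%N.

Section SpinSystem.
(* A spin system given by the (multiplicative) weights
   Ue s t = exp(U(s,t)) in [0,oo)  (U(s,t) = -oo  <->  Ue s t = 0), and
   Wv s = exp(W(s)) > 0. *)
Context (R : numFieldType) (d : nat) (S : finType) (Ue : S -> S -> R) (Wv : S -> R).

(* Boundary conditions: psi : site d -> option S; psi w = Some s means w is in
   A^psi with spin s, None means w is not in A^psi.  Only values at dV matter. *)
Definition gibbs_weight (T : finType) (pos : T -> site d)
    (psi : site d -> option S) (sigma : {ffun T -> S}) : R :=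
  (\prod_(p : T * T | ((enum_rank p.1 < enum_rank p.2)%N
                        && adjacent (pos p.1) (pos p.2)))
       Ue (sigma p.1) (sigma p.2))
  * (\prod_(v : T) \prod_(i < d) \prod_(b : bool)
       (if boundary pos (nbr (pos v) i b) then
          (if psi (nbr (pos v) i b) is Some s then Ue s (sigma v) else 1)
        else 1))
  * \prod_(v : T) Wv (sigma v).

Definition partition_fn (T : finType) (pos : T -> site d) psi : R :=
  \sum_(sigma : {ffun T -> S}) gibbs_weight pos psi sigma.

Definition gibbs (T : finType) (pos : T -> site d) psi (sigma : {ffun T -> S}) : R :=
  gibbs_weight pos psi sigma / partition_fn pos psi.

Definition marginal (T : finType) (pos : T -> site d) psi (B : {set T})
    (tau : {ffun {x : T | x \in B} -> S}) : R :=
  \sum_(sigma : {ffun T -> S} | [forall x : {x : T | x \in B}, sigma (val x) == tau x])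
     gibbs pos psi sigma.

Definition tv_marginal (T : finType) (pos : T -> site d) (psi psi' : site d -> option S) (B : {set T}) : R :=
  2^-1 * \sum_(tau : {ffun {x : T | x \in B} -> S})
            `|marginal pos psi tau - marginal pos psi' tau|.

Definition block_kernel (T : finType) (pos : T -> site d) psi (I : finType)
    (A : I -> {set T}) (sigma tau : {ffun T -> S}) : R :=
  #|I|%:R^-1 * \sum_(i : I)
     (if [forall x in ~: A i, sigma x == tau x] then
        gibbs pos psi tau /
          \sum_(rho : {ffun T -> S} | [forall x in ~: A i, sigma x == rho x])
             gibbs pos psi rho
      else 0).

Definition valid_cfg (T : finType) (pos : T -> site d) psi : pred {ffun T -> S} :=
  fun sigma => 0 < gibbs pos psi sigma.

Definition block_matrix (T : finType) (pos : T -> site d) psi (I : finType)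
    (A : I -> {set T}) :
    'M[R]_#|{: {sigma : {ffun T -> S} | valid_cfg pos psi sigma}}| :=
  \matrix_(i, j) block_kernel pos psi A (val (enum_val i)) (val (enum_val j)).

Definition permissive : Prop :=
  forall (T : finType) (pos : T -> site d) (psi : site d -> option S),
    injective pos -> exists sigma : {ffun T -> S}, valid_cfg pos psi sigma.

Definition glauber_irreducible : Prop :=
  forall (T : finType) (pos : T -> site d) (psi : site d -> option S),
    injective pos ->
    forall sigma tau : {sigma : {ffun T -> S} | valid_cfg pos psi sigma},
      connect (fun x y : {sigma : {ffun T -> S} | valid_cfg pos psi sigma} =>
                 0 < block_kernel pos psi (fun v : T => [set v]) (val x) (val y))
              sigma tau.

(* Strong spatial mixing, with e^{-a} written as theta in (0,1). *)
Definition SSM : Prop :=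
  exists2 b : R, 0 < b & exists2 theta : R, (0 < theta < 1) &
    forall (a : site d) (L : nat), (0 < L)%N ->
    forall (B : {set cube d L}) (u : site d) (psi psi' : site d -> option S),
      boundary (cube_pos (L:=L) a) u ->
      (forall w, w != u -> psi w = psi' w) ->
      tv_marginal (cube_pos (L:=L) a) psi psi' B
        <= b * theta ^+ dist_set (cube_pos (L:=L) a) u B.

End SpinSystem.

(* lambda(P) = 1 - max(|lambda_2|, |lambda_N|), computed from the eigenvalues
   s = [lambda_1 >= ... >= lambda_N] listed with multiplicity. *)
Definition gap_of_spectrum (R : realDomainType) (s : seq R) : R :=
  1 - \big[Num.max/0]_(x <- behead s) `|x|.

Definition spectral_gap_ge (R : realDomainType) (n : nat) (M : 'M[R]_n) (g : R) : Prop :=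
  exists s : seq R,
    [/\ sorted (fun x y : R => y <= x) s,
        char_poly M = \prod_(x <- s) ('X - x%:P)
      & g <= gap_of_spectrum s].

(* Main.v *)
Require Import Defs.
From HB Require Import structures.
From mathcomp Require Import all_boot all_order all_algebra.
From mathcomp Require Import sesquilinear spectral complex.
From mathcomp Require Import ring lra zify.
Import Order.TTheory GRing.Theory Num.Theory.
Local Open Scope ring_scope.

Set Implicit Arguments. Unset Strict Implicit. Unset Printing Implicit Defensive.

(** Let [P_A] be the conditional expectation given the spins outside [A]. It is an orthogonal
    projection in L2 of the Gibbs measure, and the block dynamics is the average of the [P_{A_i}];
    hence it is positive semidefinite, and a spectral gap of order 1/r amounts to |f|^2 <= C sum_i
    |f - P_{A_i} f|^2 for centred f, with C independent of the cube, the boundary condition and the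
    blocks ([block_gap]).

    The inequality is first proved for single sites ([glauber_gap]). On a large cube, a random
    subcube of side l is resampled. A discrepancy at v disappears if the subcube contains v and can
    spread only if v lies on its outer boundary; SSM then bounds the spread by a multiple of m^d
    plus an exponentially small term ([spec_lipschitz_boundary]). The subcubes are weighted so that
    the bad event is rarer than the good one by a factor of order q, so for suitable m and q the
    Lipschitz constant of f contracts on average. Self-adjointness turns this into an L2 bound
    without any loss in the volume ([decay_one_step], [weighted_gap]). Inside a subcube,
    irreducibility and finiteness give a gap that depends only on its side ([local_gap]).

    To pass from sites to blocks, let E and O resample all even and all odd sites of the bipartite
    lattice. A detectability argument ([layered_gap]) derives |f|^2 <= C' (|f - E f|^2 + |f - O
    f|^2) from the single-site inequality. Within one layer the site projections commute, so |f - E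
    f|^2 <= sum_i |f - E_i f|^2, where E_i resamples the even sites of A_i ([scan_cover]). Since E_i
    fixes P_{A_i} f, the i-th term is at most |f - P_{A_i} f|^2; likewise for O.

    Finally [reversible_spectral_gap] converts the quadratic form inequality into a statement about
    the ordered spectrum, by symmetrising the transition matrix. *)

(** * Weighted inner products and orthogonal projections *)

Section WeightedL2.
Context (R : realFieldType) (X : finType) (mu : X -> R).
Context (mu_ge0 : forall x, 0 <= mu x).

Definition dot (f g : {ffun X -> R^o}) : R := \sum_x mu x * ((f x : R) * g x).
Definition sqnorm (f : {ffun X -> R^o}) : R := dot f f.

Lemma dotC f g : dot f g = dot g f.
Proof. by apply: eq_bigr => x _; rewrite [f x * _]mulrC. Qed.

Lemma dotDl f g h : dot (f + g) h = dot f h + dot g h.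
Proof.
rewrite -big_split; apply: eq_bigr => x _ /=.
by rewrite ffunE mulrDl mulrDr.
Qed.

Lemma dotZl a f g : dot (a *: f) g = a * dot f g.
Proof.
rewrite mulr_sumr; apply: eq_bigr => x _; rewrite ffunE /=.
by rewrite -mulrA mulrCA.
Qed.

Lemma dotNl f g : dot (- f) g = - dot f g.
Proof. by rewrite -scaleN1r dotZl mulN1r. Qed.

Lemma dotBl f g h : dot (f - g) h = dot f h - dot g h.
Proof. by rewrite dotDl dotNl. Qed.

Lemma dotDr f g h : dot h (f + g) = dot h f + dot h g.
Proof. by rewrite dotC dotDl !(dotC h). Qed.

Lemma dotZr a f g : dot g (a *: f) = a * dot g f.
Proof. by rewrite dotC dotZl dotC. Qed.

Lemma dotBr f g h : dot h (f - g) = dot h f - dot h g.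
Proof. by rewrite dotC dotBl !(dotC h). Qed.

Lemma dot_sumr (I : Type) (s : seq I) (P : pred I) (F : I -> {ffun X -> R^o}) g :
  dot g (\sum_(i <- s | P i) F i) = \sum_(i <- s | P i) dot g (F i).
Proof.
elim/big_rec2: _ => [|i y1 y2 _ <-]; last by rewrite dotDr.
by rewrite -(scale0r 0) dotZr mul0r.
Qed.

Lemma sqnorm_ge0 f : 0 <= sqnorm f.
Proof. by apply: sumr_ge0 => x _; rewrite mulr_ge0 // -expr2 sqr_ge0. Qed.

Lemma sqnorm0 : sqnorm 0 = 0.
Proof. by rewrite /sqnorm -(scale0r 0) dotZl mul0r. Qed.

Lemma sqnormB f g : sqnorm (f - g) = sqnorm f - 2 * dot f g + sqnorm g.
Proof. rewrite /sqnorm dotBl !dotBr (dotC g f); ring. Qed.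

Lemma sqnormD f g : sqnorm (f + g) = sqnorm f + 2 * dot f g + sqnorm g.
Proof. rewrite /sqnorm dotDl !dotDr (dotC g f); ring. Qed.

Lemma sqnormZ a f : sqnorm (a *: f) = a ^+ 2 * sqnorm f.
Proof. by rewrite /sqnorm dotZl dotZr mulrA. Qed.

(** The weights may vanish, so [sqnorm] is only a seminorm and a null vector [g] is treated apart:
    [sqnorm (f - t *: g)] is then affine in [t] and nonnegative, which forces [dot f g = 0]. *)
Lemma cauchy_schwarz f g : dot f g ^+ 2 <= sqnorm f * sqnorm g.
Proof.
have [g0|g0] := eqVneq (sqnorm g) 0; last first.
  have gp : 0 < sqnorm g by rewrite lt_def g0 sqnorm_ge0.
  have := sqnorm_ge0 (sqnorm g *: f - dot f g *: g).
  rewrite sqnormB !sqnormZ dotZl dotZr => h.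
  have : 0 <= sqnorm g * (sqnorm f * sqnorm g - dot f g ^+ 2).
    by apply: le_trans h _; rewrite le_eqVlt; apply/orP; left; apply/eqP; ring.
  by rewrite pmulr_rge0 // subr_ge0.
rewrite g0 mulr0 le_eqVlt; apply/orP; left.
rewrite sqrf_eq0; apply/eqP.
apply/eqP/negP => /negP fg0.
(* For this multiple of [g] the squared norm would equal -1. *)
have := sqnorm_ge0 (f - ((sqnorm f + 1) / (2 * dot f g)) *: g).
rewrite sqnormB sqnormZ g0 mulr0 addr0 dotZr.
have -> : 2 * ((sqnorm f + 1) / (2 * dot f g) * dot f g) = sqnorm f + 1.
  by field.
lra.
Qed.

Lemma sqnormB_young (a : R) f g : 0 < a ->
  sqnorm (f - g) <= (1 + a^-1) * sqnorm f + (1 + a) * sqnorm g.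
Proof.
move=> a0; have := sqnorm_ge0 (f + a *: g).
rewrite sqnormD sqnormZ dotZr sqnormB => h.
have : 0 <= a^-1 * (sqnorm f + 2 * (a * dot f g) + a ^+ 2 * sqnorm g).
  by apply: mulr_ge0 => //; rewrite invr_ge0 ltW.
have -> : a^-1 * (sqnorm f + 2 * (a * dot f g) + a ^+ 2 * sqnorm g) =
   a^-1 * sqnorm f + 2 * dot f g + a * sqnorm g.
  by field; rewrite gt_eqF.
lra.
Qed.

Lemma sqnormB_le2 f g : sqnorm (f - g) <= 2 * sqnorm f + 2 * sqnorm g.
Proof. by have := sqnormB_young f g (@ltr01 R); rewrite invr1. Qed.

Definition projection (P : {ffun X -> R^o} -> {ffun X -> R^o}) : Prop :=
  [/\ forall a f g, P (a *: f + g) = a *: P f + P g,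
      forall f, P (P f) = P f
    & forall f g, dot (P f) g = dot f (P g)].

Section Projection.
Context (P : {ffun X -> R^o} -> {ffun X -> R^o}) (HP : projection P).

Lemma projection_sub f g : P (f - g) = P f - P g.
Proof. by case: HP => lin _ _; rewrite addrC -scaleN1r lin scaleN1r addrC. Qed.

Lemma projection_dot f : dot f (P f) = sqnorm (P f).
Proof. by case: HP => _ idem sa; rewrite /sqnorm sa idem. Qed.

Lemma projection_pythagoras f : sqnorm (f - P f) = sqnorm f - sqnorm (P f).
Proof. rewrite sqnormB projection_dot; ring. Qed.

Lemma projection_contract f : sqnorm (P f) <= sqnorm f.
Proof. by rewrite -subr_ge0 -projection_pythagoras sqnorm_ge0. Qed.

Lemma projection_cocontract f : sqnorm (f - P f) <= sqnorm f.
Proof. by rewrite projection_pythagoras lerBlDr lerDl sqnorm_ge0. Qed.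

End Projection.

(** * Products of projections and the two-layer bound *)

Section Layers.
Context (T : finType) (P : T -> {ffun X -> R^o} -> {ffun X -> R^o}).
Context (projP : forall v, projection (P v)).

(** The product of the projections listed in [s]; the last site of the list acts first. *)
Definition scan (s : seq T) (f : {ffun X -> R^o}) := foldr P f s.

Lemma scan_commute (v : T) (s : seq T) f :
  (forall u, u \in s -> forall g, P v (P u g) = P u (P v g)) ->
  P v (scan s f) = scan s (P v f).
Proof.
elim: s => //= u s IH H; rewrite H ?mem_head // IH // => w ws.
by apply: H; rewrite in_cons ws orbT.
Qed.

Lemma scan_fixed (v : T) (s : seq T) f :
  (forall u w, u \in s -> w \in s -> forall g, P u (P w g) = P w (P u g)) ->
  v \in s -> P v (scan s f) = scan s f.
Proof.
elim: s => //= u s IH H; rewrite in_cons.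
have Hs : forall u w, u \in s -> w \in s -> forall g, P u (P w g) = P w (P u g).
  by move=> a b sa sb; apply: H; rewrite in_cons ?sa ?sb orbT.
case/orP => [/eqP ->|vs]; first by case: (projP u).
by rewrite H ?in_cons ?eqxx ?vs ?orbT // IH.
Qed.

Lemma scan_projection (s : seq T) :
  (forall u w, u \in s -> w \in s -> forall g, P u (P w g) = P w (P u g)) ->
  projection (scan s).
Proof.
elim: s => /= [_|u s IH H]; first by split.
have Hs : forall u w, u \in s -> w \in s -> forall g, P u (P w g) = P w (P u g).
  by move=> a b sa sb; apply: H; rewrite in_cons ?sa ?sb orbT.
have [lin idem sa] := IH Hs; have [linu idemu sau] := projP u.
have com f : P u (scan s f) = scan s (P u f).
  by apply: scan_commute => w ws; apply: H; rewrite ?in_cons ?eqxx ?ws ?orbT.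
split => [a f g|f|f g] /=; first by rewrite lin linu.
- by rewrite -com idem idemu.
- by rewrite sau sa com.
Qed.

Lemma scan_fix (s : seq T) f : (forall v, v \in s -> P v f = f) -> scan s f = f.
Proof.
elim: s => //= u s IH H; rewrite IH ?H ?mem_head // => v vs.
by apply: H; rewrite in_cons vs orbT.
Qed.

(** Pythagoras at each step: the norm lost by the scan is the sum of its squared increments. *)
Lemma scan_telescope (s : seq T) f :
  \sum_(i < size s) (let h := scan (drop i.+1 s) f in
     sqnorm (h - P (tnth (in_tuple s) i) h)) = sqnorm f - sqnorm (scan s f).
Proof.
elim: s => [|u s IH]; first by rewrite big_ord0 subrr.
rewrite big_ord_recl /= drop0 (tnth_nth u) /= projection_pythagoras //.
rewrite (eq_bigr (fun i : 'I_(size s) => let h := scan (drop i.+1 s) f in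
   sqnorm (h - P (tnth (in_tuple s) i) h))) ?IH; last first.
  by move=> i _; rewrite !(tnth_nth u) /=.
by rewrite addrC addrA subrK.
Qed.

(* [v] commutes through the scan except at the [nb]-related sites, each of which costs one increment of the scan. *)
Lemma scan_defect (nb : rel T) (v : T) (s : seq T) g :
  (forall u, u \in s -> ~~ nb u v -> forall f, P v (P u f) = P u (P v f)) ->
  P v g = g ->
  sqnorm (scan s g - P v (scan s g)) <=
    (count (nb^~ v) s)%:R *
    \sum_(i < size s | nb (tnth (in_tuple s) i) v)
      (let h := scan (drop i.+1 s) g in sqnorm (h - P (tnth (in_tuple s) i) h)).
Proof.
move=> + gv; elim: s => [|u s IH] H; first by rewrite big_ord0 mulr0 /= gv subrr sqnorm0.
have Hs : forall u, u \in s -> ~~ nb u v -> forall f, P v (P u f) = P u (P v f).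
  by move=> w ws; apply: H; rewrite in_cons ws orbT.
rewrite big_mkcond big_ord_recl -big_mkcond /= drop0 (tnth_nth u) /=.
set S1 := \sum_(i < size s | _) _.
have -> : S1 = \sum_(i < size s | nb (tnth (in_tuple s) i) v)
      (let h := scan (drop i.+1 s) g in sqnorm (h - P (tnth (in_tuple s) i) h)).
  by apply: eq_big => [i|i _]; rewrite !(tnth_nth u).
set S2 := \sum_(i < size s | _) _; set h := scan s g.
have S2_ge0 : 0 <= S2 by apply: sumr_ge0 => i _; apply: sqnorm_ge0.
have := IH Hs; rewrite -/S2 -/h.
case: ifPn => nuv; last first.
  rewrite !add0r add0n H ?mem_head // -projection_sub // => IHs.
  exact: le_trans (projection_contract (projP u) _) IHs.
set k := count _ _ => IHs.
set y := h - P u h.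
(* The defect of [P u h] at [v] is the defect of [h] minus that of the new increment [y]. *)
have -> : P u h - P v (P u h) = (h - P v h) - (y - P v y).
  by rewrite /y (projection_sub (projP v)); apply/ffunP => x; rewrite !ffunE; ring.
have yle := projection_cocontract (projP v) y.
(* Without earlier neighbours [h] has defect of norm zero, and Cauchy-Schwarz removes the cross
   term. *)
have [k0|k0] := posnP k.
  move: IHs; rewrite k0 mul0r => IHs.
  have xz : sqnorm (h - P v h) = 0 by apply/eqP; rewrite eq_le IHs sqnorm_ge0.
  have := cauchy_schwarz (h - P v h) (y - P v y); rewrite xz mul0r => cs0.
  have d0 : dot (h - P v h) (y - P v y) = 0.
    by apply/eqP; rewrite -sqrf_eq0 eq_le cs0 sqr_ge0.
  rewrite sqnormB d0 xz addn0 mul1r; lra.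
have kR : (0 : R) < k%:R by rewrite ltr0n.
(* With parameter k, (1 + 1/k) k = k + 1, so both terms carry the same factor k + 1. *)
apply: le_trans (sqnormB_young _ _ kR) _.
rewrite natrD mulrDr addrC lerD //.
  by rewrite ler_pM2l //; apply: addr_gt0.
apply: le_trans (ler_wpM2l _ IHs) _; first by rewrite addr_ge0 // invr_ge0 ltW.
by rewrite mulrA ler_wpM2r // mulrDl mul1r mulVf ?gt_eqF // addrC.
Qed.

Context (nb : rel T) (E : {set T}) (Delta : nat).
Context (degL : forall v, (#|[set u | nb u v]| <= Delta)%N).
Context (degR : forall u, (#|[set v | nb u v]| <= Delta)%N).
Context (comm : forall u v, ~~ nb u v -> forall f, P v (P u f) = P u (P v f)).
Context (bipartite : forall u v, nb u v -> (u \in E) = (v \notin E)).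

(* The detectability lemma for a two-layer scan: a spectral gap for the sum of
   the local generators gives one for the alternation of the two layers, because
   each increment of a layer is charged by at most [Delta] neighbours. *)
Lemma layered_gap (C : R) (f : {ffun X -> R^o}) : 0 <= C ->
  (forall g, dot g (finfun (fun=> 1)) = dot f (finfun (fun=> 1)) ->
     sqnorm g <= C * \sum_v sqnorm (g - P v g)) ->
  (forall v, P v (finfun (fun=> 1)) = finfun (fun=> 1)) ->
  sqnorm f <= (2 * (1 + C * Delta%:R ^+ 2) + 1 + 2 * C * Delta%:R ^+ 2) *
     (sqnorm (f - scan (enum E) f) + sqnorm (f - scan (enum (~: E)) f)).
Proof.
move=> C0 gap P1.
have comE : forall u w, u \in enum E -> w \in enum E -> forall g, P u (P w g) = P w (P u g).
  move=> u w; rewrite !mem_enum => uE wE g; apply: comm; apply/negP => /bipartite.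
  by rewrite uE wE.
have comO : forall u w, u \in enum (~: E) -> w \in enum (~: E) ->
    forall g, P u (P w g) = P w (P u g).
  move=> u w; rewrite !mem_enum !inE => uE wE g; apply: comm; apply/negP => /bipartite.
  by rewrite uE (negbTE wE).
have PE := scan_projection comE; have PO := scan_projection comO.
set g := scan (enum E) f; set phi := scan (enum (~: E)) g.
have d1 : dot phi (finfun (fun=> 1)) = dot f (finfun (fun=> 1)).
  have [_ _ saE] := PE; have [_ _ saO] := PO.
  by rewrite saO scan_fix // saE scan_fix.
have inc_ge0 (i : 'I_(size (enum (~: E)))) :
    0 <= (let h := scan (drop i.+1 (enum (~: E))) g in
          sqnorm (h - P (tnth (in_tuple (enum (~: E))) i) h)).
  by apply: sqnorm_ge0.
(* A site outside [E] fixes [phi]. A site of [E] fixes [g], and [scan_defect] charges its defect to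
   the increments at its neighbours. *)
have loc v : sqnorm (phi - P v phi) <= Delta%:R *
    \sum_(i < size (enum (~: E)) | nb (tnth (in_tuple (enum (~: E))) i) v)
      (let h := scan (drop i.+1 (enum (~: E))) g in
       sqnorm (h - P (tnth (in_tuple (enum (~: E))) i) h)).
  have [vE|vE] := boolP (v \in E); last first.
    rewrite scan_fixed ?mem_enum ?inE ?vE // subrr sqnorm0.
    by rewrite mulr_ge0 // sumr_ge0.
  apply: le_trans (@scan_defect nb v _ _ _ _) _.
  - by move=> u _ nuv f'; apply: comm.
  - by apply: scan_fixed; rewrite ?mem_enum.
  apply: ler_wpM2r; first exact: sumr_ge0.
  rewrite ler_nat; apply: leq_trans (degL v).
  rewrite -size_filter cardE; apply: uniq_leq_size.
    exact/filter_uniq/enum_uniq.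
  by move=> u; rewrite mem_filter !mem_enum !inE => /andP[].
(* After exchanging the sums, each increment is charged by at most [Delta] sites, and the increments
   telescope. *)
have tot : \sum_v sqnorm (phi - P v phi) <= Delta%:R ^+ 2 * (sqnorm g - sqnorm phi).
  apply: le_trans; first by apply: ler_sum => v _; exact: (loc v).
  rewrite -mulr_sumr expr2 -mulrA ler_wpM2l // -scan_telescope.
  under eq_bigr => v _ do rewrite big_mkcond.
  rewrite exchange_big mulr_sumr ler_sum // => i _.
  rewrite -big_mkcond sumr_const /=.
  rewrite -[X in X <= _]mulr_natl ler_wpM2r // ler_nat.
  apply: leq_trans (degR (tnth (in_tuple (enum (~: E))) i)).
  by rewrite cardsE.
have gapphi := le_trans (gap _ d1) (ler_wpM2l C0 tot).
have gO := projection_pythagoras PO g; rewrite -/phi in gO.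
have fE := projection_pythagoras PE f; rewrite -/g in fE.
(* Writing g = f - (f - g) and applying the contraction 1 - O, where O is the scan of the complement
   of [E]. *)
have gf : sqnorm (g - phi) <= 2 * sqnorm (f - scan (enum (~: E)) f) + 2 * sqnorm (f - g).
  have -> : g - phi = (f - scan (enum (~: E)) f) -
      ((f - g) - scan (enum (~: E)) (f - g)).
    rewrite (projection_sub PO) -/phi; apply/ffunP => x; rewrite !ffunE; ring.
  apply: le_trans (sqnormB_le2 _ _) _; rewrite lerD2l.
  by rewrite ler_wpM2l // projection_cocontract.
set D2 := Delta%:R ^+ 2 in gapphi *.
have D2_ge0 : 0 <= D2 by rewrite sqr_ge0.
rewrite mulrA -gO in gapphi.
have CD : 0 <= C * D2 by rewrite mulr_ge0.
set K := C * D2 in gapphi CD *.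
have a0 := sqnorm_ge0 (f - g); have b0 := sqnorm_ge0 (f - scan (enum (~: E)) f).
set a := sqnorm (f - g) in fE gf a0 *; set b := sqnorm (f - _) in gf b0 *.
have h1 : sqnorm f <= (1 + K) * sqnorm (g - phi) + a by lra.
have h2 : (1 + K) * sqnorm (g - phi) <= (1 + K) * (2 * b + 2 * a).
  by rewrite ler_wpM2l // addr_ge0.
apply: le_trans h1 _; rewrite -(mulrA 2 C) -/K; nra.
Qed.

End Layers.
End WeightedL2.

(** * Polynomials against exponentials *)

Lemma bernoulli (R : realFieldType) (x : R) n : 0 <= x -> 1 + n%:R * x <= (1 + x) ^+ n.
Proof.
move=> x0; elim: n => [|n IH]; first by rewrite mul0r addr0 expr0.
rewrite exprS -natr1; have n0 : (0 : R) <= n%:R by [].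
have h : (1 + x) * (1 + n%:R * x) <= (1 + x) * (1 + x) ^+ n.
  by rewrite ler_wpM2l // addr_ge0.
by apply: le_trans h; have := mulr_ge0 (mulr_ge0 n0 x0) x0; lra.
Qed.

(** Bernoulli gives j dl theta^j <= 1 with dl = 1/theta - 1. Raised to the power k + 1 this bounds
    theta^m for m = j (k+1), and j >= C (k+1)^k / dl^(k+1) absorbs the factor C m^k. *)
Lemma poly_exp_small (R : archiRealFieldType) (C theta : R) (k : nat) :
  0 <= C -> 0 < theta < 1 -> exists2 m, (0 < m)%N & C * m%:R ^+ k * theta ^+ m <= 1.
Proof.
move=> C0 /andP[t0 t1]; set dl := theta^-1 - 1.
have d0 : 0 < dl by rewrite subr_gt0 invf_gt1.
set x := C * k.+1%:R ^+ k / dl ^+ k.+1.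
have x0 : 0 <= x by rewrite !mulr_ge0 // ?exprn_ge0 // invr_ge0 exprn_ge0 // ltW.
exists ((Num.bound x).+1 * k.+1)%N => //; set j := (Num.bound x).+1.
have xj : x <= j%:R.
  apply: ltW; apply: lt_trans (archi_boundP x0) _; by rewrite ltr_nat.
have td : 0 <= theta ^+ j by rewrite exprn_ge0 // ltW.
have h1 : j%:R * dl * theta ^+ j <= 1.
  have := bernoulli j (ltW d0).
  have -> : 1 + dl = theta^-1 by rewrite /dl addrC subrK.
  move=> /(ler_wpM2r td); rewrite exprVn mulVf ?expf_neq0 ?gt_eqF //.
  by apply: le_trans; rewrite ler_wpM2r // lerDr.
have h2 : (j%:R * dl) ^+ k.+1 * theta ^+ (j * k.+1) <= 1.
  rewrite exprM -exprMn exprn_ile1 // mulr_ge0 // mulr_ge0 // ltW //.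
apply: le_trans h2; rewrite ler_wpM2r //; first by rewrite exprn_ge0 // ltW.
rewrite natrM exprMn [(_ * dl) ^+ _]exprMn exprS.
move: xj; rewrite /x ler_pdivrMr ?exprn_gt0 // => xj.
have jk : (0 : R) <= j%:R ^+ k by rewrite exprn_ge0.
have := ler_wpM2r jk xj; congr (_ <= _); ring.
Qed.

(** * Decay rates of self-adjoint operators *)

Section Decay.
Context (R : archiRealFieldType) (X : finType) (mu : X -> R).
Context (mu_ge0 : forall x, 0 <= mu x).
Context (P : {ffun X -> R^o} -> {ffun X -> R^o}).
Context (sa : forall f g, dot mu (P f) g = dot mu f (P g)).

(* Log-convexity of [n |-> |P^n f|^2] turns an asymptotic decay rate into a one-step bound. *)
Lemma decay_one_step (f : {ffun X -> R^o}) (M rho : R) : 0 < rho ->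
  (forall n, sqnorm mu (iter n P f) <= M * (rho ^+ 2) ^+ n) ->
  dot mu f (P f) <= rho * sqnorm mu f.
Proof.
move=> rho0 decay; pose a n := sqnorm mu (iter n P f).
have a_ge0 n : 0 <= a n by apply: sqnorm_ge0.
have logc n : a n.+1 ^+ 2 <= a n * a n.+2.
  by rewrite /a [sqnorm mu (iter n.+1 P f)]/sqnorm [iter n.+1 P f]iterS sa -!iterS cauchy_schwarz.
set s := rho ^+ 2 in decay; have s0 : 0 < s by rewrite exprn_gt0.
suff h : a 1%N <= s * a 0%N.
  have := cauchy_schwarz mu_ge0 f (P f); rewrite -/(a 0%N) => cs.
  have /(le_trans cs) : a 0%N * sqnorm mu (P f) <= (rho * a 0%N) ^+ 2.
    by rewrite exprMn -/s [a _ ^+ 2]expr2 mulrCA ler_wpM2l.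
  have [//|d0] := leP (dot mu f (P f)) (rho * a 0%N).
  have p0 : 0 <= rho * a 0%N by rewrite mulr_ge0 // ltW.
  by rewrite ler_pXn2r // ?nnegrE ?(le_trans p0 (ltW d0)) // leNgt d0.
(* If [a 1 > s * a 0], log-convexity keeps all later ratios at least t = a 1 / a 0 > s, so (t/s)^n
   would stay bounded, against Bernoulli. *)
rewrite leNgt; apply/negP => lt1.
have a1 : 0 < a 1%N by apply: le_lt_trans lt1; rewrite mulr_ge0 // ltW.
have a0 : 0 < a 0%N.
  rewrite lt_def a_ge0 andbT; apply/eqP => a0.
  by have := logc 0%N; rewrite a0 mul0r leNgt exprn_gt0.
set t := a 1%N / a 0%N.
have t0 : 0 < t by rewrite divr_gt0.
have st : s < t by rewrite ltr_pdivlMr.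
have grow n : 0 < a n /\ t * a n <= a n.+1.
  elim: n => [|n [an IH]]; first by rewrite /t divfK ?gt_eqF.
  have an1 : 0 < a n.+1 by apply: lt_le_trans IH; rewrite mulr_gt0.
  split=> //; rewrite -(ler_pM2l an) (le_trans _ (logc n)) //.
  by rewrite expr2 mulrA [a n * t]mulrC ler_wpM2r.
have pw n : t ^+ n * a 0%N <= a n.
  elim: n => [|n IH]; first by rewrite expr0 mul1r.
  by apply: le_trans (grow n).2; rewrite exprS -mulrA ler_pM2l.
have ts : 0 < t / s - 1 by rewrite subr_gt0 ltr_pdivlMr // mul1r.
have bnd n : n%:R * (t / s - 1) <= M / a 0%N.
  have := bernoulli n (ltW ts).
  have -> : 1 + (t / s - 1) = t / s by ring.
  have : (t / s) ^+ n <= M / a 0%N.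
    rewrite ler_pdivlMr // expr_div_n mulrAC ler_pdivrMr ?exprn_gt0 //.
    exact: le_trans (pw n) (decay n).
  lra.
have M0 : 0 <= M / a 0%N / (t / s - 1).
  by rewrite divr_ge0 // ?(ltW ts) //; have := bnd 0%N; rewrite mul0r.
have := bnd (Num.bound (M / a 0%N / (t / s - 1))).
rewrite -ler_pdivlMr // leNgt archi_boundP //.
Qed.

End Decay.

(** * Products over edges and lattice neighbours *)

(** A symmetric edge product may list each edge in either orientation. [gibbs_weight] orients edges
    by [enum_rank], an order that an embedding of regions need not preserve. *)
Lemma prod_orientation (R : comPzSemiRingType) (A : finType) (F : A * A -> R) (r1 r2 : rel A) :
  (forall x y, F (x, y) = F (y, x)) ->
  (forall x y, r1 x y -> ~~ r1 y x) -> (forall x y, r2 x y -> ~~ r2 y x) ->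
  (forall x y, r1 x y || r1 y x = r2 x y || r2 y x) ->
  \prod_(p | r1 p.1 p.2) F p = \prod_(p | r2 p.1 p.2) F p.
Proof.
move=> Fsym as1 as2 e12.
rewrite (bigID (fun p => r2 p.1 p.2)) [RHS](bigID (fun p => r1 p.1 p.2)) /=.
congr (_ * _); first by apply: eq_bigl => p; rewrite andbC.
rewrite (reindex_inj (h := fun p => (p.2, p.1))) /=; last by move=> [a b] [c e] [-> ->].
apply: eq_big => [[x y] /=|[x y] _ /=]; last exact: Fsym.
have := e12 x y; have := as1 x y; have := as1 y x; have := as2 x y; have := as2 y x.
by case: (r1 x y); case: (r1 y x); case: (r2 x y); case: (r2 y x) => //= a b c e _;
   first [case: (a isT) | case: (b isT) | case: (c isT) | case: (e isT)].
Qed.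

Lemma big_codom (R : Type) (idx : R) (op : Monoid.com_law idx) (T' T : finType) (h : T' -> T)
    (P : pred T) (F : T -> R) : injective h ->
  \big[op/idx]_(t | (t \in codom h) && P t) F t = \big[op/idx]_(t | P (h t)) F (h t).
Proof.
move=> hinj.
rewrite (reindex_omap h (fun t => [pick t' | h t' == t])) /=; last first.
  move=> t /andP[/codomP[t' ->] _]; case: pickP => [t'' /eqP /= ->//|/(_ t')].
  by rewrite eqxx.
apply: eq_bigl => t; rewrite codom_f /=; case: pickP => [t' /eqP /hinj ->|/(_ t)].
  by rewrite eqxx andbT.
by rewrite eqxx.
Qed.

Section Lattice.
Context (d : nat).
Implicit Types u w : site d.

Lemma adjacentC u w : adjacent u w = adjacent w u.
Proof.
by rewrite /adjacent /l1dist; congr (_ == _); apply: eq_bigr => i _; rewrite distnC.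
Qed.

Lemma adjacent_irrefl u : adjacent u u = false.
Proof. by rewrite /adjacent /l1dist big1 // => i _; rewrite subrr. Qed.

Lemma nbr_inj u i b j c : nbr u i b = nbr u j c -> (i, b) = (j, c).
Proof.
move=> /(congr1 (fun f : site d => f i)); rewrite !ffunE eqxx.
by case: eqP => [->|_]; case: b; case: c => //; lia.
Qed.

Lemma adjacentP u w : reflect (exists i b, w = nbr u i b) (adjacent u w).
Proof.
apply: (iffP eqP) => [|[i [b ->]]]; last first.
  rewrite /l1dist (bigD1 i) //= big1; last first.
    by move=> j /negPf ji; rewrite !ffunE ji subrr.
  by rewrite ffunE eqxx; case: b; lia.
move=> dist1.
have [i ui|uw] := pickP (fun i => u i != w i); last first.
  by move: dist1; rewrite /l1dist big1 // => i _; have /negbFE/eqP-> := uw i; rewrite subrr.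
move: dist1; rewrite /l1dist (bigD1 i) //=.
set rest := (\sum_(j < d | j != i) _)%N => e.
have [e1 e2] : absz (u i - w i) = 1%N /\ rest = 0%N by move: ui; lia.
have wj j : j != i -> w j = u j.
  move=> ji; move/eqP: e2; rewrite /rest sum_nat_eq0 => /forallP/(_ j).
  by rewrite ji; lia.
exists i, (u i < w i); apply/ffunP => j; rewrite !ffunE.
case: eqP => [->|/eqP/wj//]; by move: e1; clear; move: (u i) (w i) => x y; case: ltP => h e;
  [have : y = x + 1 by lia|have : y = x - 1 by lia].
Qed.

(** At most one of the 2d directions leads from [u] to [w], so a product over directions collapses
    to one factor per adjacent site. *)
Lemma prod_nbr (R : comPzSemiRingType) u w (x : R) :
  \prod_(i < d) \prod_(b : bool) (if w == nbr u i b then x else 1) =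
  if adjacent u w then x else 1.
Proof.
rewrite pair_big -big_mkcond /=.
case: adjacentP => [[i [b ->]]|H].
  rewrite (big_pred1 (i, b)) // => -[j c] /=.
  by apply/eqP/eqP => [/nbr_inj|[-> ->]].
rewrite big_pred0 // => -[i b] /=; apply/eqP => e; case: H; by exists i, b.
Qed.

End Lattice.

(** * Gibbs weights of glued configurations *)

Section Specification.
Context (R : realFieldType) (d : nat) (S : finType) (Ue : S -> S -> R) (Wv : S -> R).
Context (Ue_ge0 : forall s t, 0 <= Ue s t) (Ue_sym : forall s t, Ue s t = Ue t s).
Context (Wv_gt0 : forall s, 0 < Wv s).

Lemma gibbs_weight_ge0 (T : finType) (pos : T -> site d) psi sigma :
  0 <= gibbs_weight Ue Wv pos psi sigma.
Proof.
rewrite /gibbs_weight !mulr_ge0 //; apply: prodr_ge0 => v _ //; last exact: ltW.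
apply: prodr_ge0 => i _; apply: prodr_ge0 => b _.
by case: ifP => // _; case: (psi _).
Qed.

Lemma partition_fn_ge0 (T : finType) (pos : T -> site d) psi :
  0 <= partition_fn Ue Wv pos psi.
Proof. by apply: sumr_ge0 => s _; apply: gibbs_weight_ge0. Qed.

Lemma gibbs_ge0 (T : finType) (pos : T -> site d) psi sigma :
  0 <= gibbs Ue Wv pos psi sigma.
Proof. by rewrite divr_ge0 ?gibbs_weight_ge0 ?partition_fn_ge0. Qed.

Lemma eq_gibbs_weight (T : finType) (pos : T -> site d) psi psi' sigma :
  (forall w, boundary pos w -> psi w = psi' w) ->
  gibbs_weight Ue Wv pos psi sigma = gibbs_weight Ue Wv pos psi' sigma.
Proof.
move=> e; rewrite /gibbs_weight; congr (_ * _ * _).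
apply: eq_bigr => v _; apply: eq_bigr => i _; apply: eq_bigr => b _.
by case: ifP => // /e ->.
Qed.

Lemma eq_gibbs (T : finType) (pos : T -> site d) psi psi' sigma :
  (forall w, boundary pos w -> psi w = psi' w) ->
  gibbs Ue Wv pos psi sigma = gibbs Ue Wv pos psi' sigma.
Proof.
move=> e; rewrite /gibbs (eq_gibbs_weight sigma e); congr (_ / _).
by apply: eq_bigr => s _; apply: eq_gibbs_weight.
Qed.

Definition glue (T' T : finType) (h : T' -> T) (tau : {ffun T' -> S}) (sigma : {ffun T -> S}) :=
  [ffun t => if [pick t' | h t' == t] is Some t' then tau t' else sigma t].

(* The boundary condition seen from a subregion when the rest of the region is in state [sigma]. *)
Definition bc (T : finType) (pos : T -> site d) (psi : site d -> option S) (sigma : {ffun T -> S})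
    (w : site d) : option S :=
  if [pick t | pos t == w] is Some t then Some (sigma t) else psi w.

Lemma bc_in (T : finType) (pos : T -> site d) psi sigma t :
  injective pos -> bc pos psi sigma (pos t) = Some (sigma t).
Proof.
by move=> pinj; rewrite /bc; case: pickP => [t' /eqP/pinj ->//|/(_ t)]; rewrite eqxx.
Qed.

Lemma bc_out (T : finType) (pos : T -> site d) psi sigma w :
  ~~ in_region pos w -> bc pos psi sigma w = psi w.
Proof.
rewrite /bc; case: pickP => // t /eqP <-; case/negP; apply/existsP.
by exists t.
Qed.

Section Subregion.
Context (T' T : finType) (pos' : T' -> site d) (pos : T -> site d) (h : T' -> T).
Context (hinj : injective h) (pinj : injective pos) (hpos : forall t, pos (h t) = pos' t).
Context (psi : site d -> option S).
Implicit Types (tau : {ffun T' -> S}) (sigma : {ffun T -> S}).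

Lemma pos'_inj : injective pos'.
Proof. by move=> a b; rewrite -!hpos => /pinj/hinj. Qed.

Lemma glue_in tau sigma t : glue h tau sigma (h t) = tau t.
Proof.
by rewrite ffunE; case: pickP => [t' /eqP/hinj ->//|/(_ t)]; rewrite eqxx.
Qed.

Lemma glue_out tau sigma t : t \notin codom h -> glue h tau sigma t = sigma t.
Proof.
by rewrite ffunE; case: pickP => // t' /eqP <-; rewrite codom_f.
Qed.

Lemma glue_glue tau tau' sigma : glue h tau (glue h tau' sigma) = glue h tau sigma.
Proof.
apply/ffunP => t; have [/codomP[t' ->]|tn] := boolP (t \in codom h).
  by rewrite !glue_in.
by rewrite !glue_out.
Qed.

Lemma glue_restrict sigma : glue h [ffun t => sigma (h t)] sigma = sigma.
Proof.
apply/ffunP => t; have [/codomP[t' ->]|tn] := boolP (t \in codom h).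
  by rewrite glue_in ffunE.
by rewrite glue_out.
Qed.

Lemma in_subregion t : in_region pos' (pos t) = (t \in codom h).
Proof.
apply/existsP/codomP => [[t' /eqP]|[t' ->]]; first by rewrite -hpos => /pinj <-; exists t'.
by exists t'; rewrite hpos.
Qed.

Lemma boundary_adjacent t u : adjacent (pos' t) u -> boundary pos' u = ~~ in_region pos' u.
Proof.
move=> a; rewrite /boundary; case: in_region => //=; apply/existsP; exists t.
by rewrite adjacentC.
Qed.

Lemma boundary_adjacent_super t u : adjacent (pos' t) u -> boundary pos u = ~~ in_region pos u.
Proof.
move=> a; rewrite /boundary; case: in_region => //=; apply/existsP; exists (h t).
by rewrite hpos adjacentC.
Qed.

(** A neighbour outside the subregion either belongs to the large region, where [bc] reads [sigma],
    or to its boundary, where [bc] reads [psi]; at most one of the two factors on the right differs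
    from 1. *)
Lemma boundary_factor tau sigma t i b :
  let w := nbr (pos' t) i b in
  (if boundary pos' w then
     if bc pos psi sigma w is Some s then Ue s (tau t) else 1 else 1) =
  (\prod_(t0 : T | t0 \notin codom h) (if pos t0 == w then Ue (sigma t0) (tau t) else 1)) *
  (if boundary pos w then if psi w is Some s then Ue s (tau t) else 1 else 1).
Proof.
move=> w; have aw : adjacent (pos' t) w by apply/adjacentP; exists i, b.
rewrite (boundary_adjacent aw) (boundary_adjacent_super aw).
have [/existsP[t0 /eqP e]|nw] := boolP (in_region pos w); last first.
  rewrite bc_out // big1 ?mul1r => [|t0 _]; last first.
    by case: eqP => // e; case/negP: nw; apply/existsP; exists t0; rewrite e.
  case: ifP => // /negbFE/existsP[t' /eqP e]; case/negP: nw; apply/existsP.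
  by exists (h t'); rewrite hpos e.
rewrite /= mulr1 -e in_subregion bc_in //.
have [t0h|t0h] := boolP (t0 \in codom h).
  rewrite /= big1 // => t1 t1h; case: eqP => // /pinj e1.
  by rewrite e1 t0h in t1h.
rewrite /= (bigD1 t0) //= eqxx big1 ?mulr1 // => t1 /andP[_ /negPf ne].
by case: eqP => // /pinj /eqP; rewrite ne.
Qed.

(** The spatial Markov property before normalisation: a factor either involves a site of the
    subregion, and is then part of its weight under [bc pos psi sigma], or is independent of [tau]
    and goes into [r]. *)
Lemma gibbs_weight_glue sigma :
  exists2 r : R, 0 <= r & forall tau,
    gibbs_weight Ue Wv pos psi (glue h tau sigma) =
    gibbs_weight Ue Wv pos' (bc pos psi sigma) tau * r.
Proof.
pose lt (t1 t2 : T) := (enum_rank t1 < enum_rank t2)%N && adjacent (pos t1) (pos t2).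
pose r1 := \prod_(p : T * T | lt p.1 p.2 && ((p.1 \notin codom h) && (p.2 \notin codom h)))
   Ue (sigma p.1) (sigma p.2).
pose r2 := \prod_(v | v \notin codom h) \prod_(i < d) \prod_(b : bool)
       (if boundary pos (nbr (pos v) i b) then
          (if psi (nbr (pos v) i b) is Some s then Ue s (sigma v) else 1)
        else 1).
pose r3 := \prod_(v | v \notin codom h) Wv (sigma v).
exists (r1 * r2 * r3).
  rewrite !mulr_ge0 //; apply: prodr_ge0 => v _ //; last exact: ltW.
  apply: prodr_ge0 => i _; apply: prodr_ge0 => b _.
  by case: ifP => // _; case: (psi _).
move=> tau; set om := glue h tau sigma.
have ltas x y : lt x y -> ~~ lt y x.
  by rewrite /lt => /andP[xy _]; rewrite negb_and -leqNgt ltnW.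
have ltadj x y : lt x y || lt y x = adjacent (pos x) (pos y).
  rewrite /lt [adjacent (pos y) _]adjacentC.
  case: (ltngtP (enum_rank x) (enum_rank y)) => [||/ord_inj/enum_rank_inj ->] /=;
    by rewrite ?orbF ?adjacent_irrefl.
pose F (p : T * T) := Ue (om p.1) (om p.2).
have Fsym x y : F (x, y) = F (y, x) by apply: Ue_sym.
(* Edges are inner, crossing or outer; the crossing ones will become boundary terms of the
   subregion. *)
have edges : \prod_(p | lt p.1 p.2) F p =
    (\prod_(p : T' * T' | (enum_rank p.1 < enum_rank p.2)%N && adjacent (pos' p.1) (pos' p.2))
       Ue (tau p.1) (tau p.2)) *
    (\prod_t \prod_(t0 | t0 \notin codom h)
       (if adjacent (pos' t) (pos t0) then Ue (sigma t0) (tau t) else 1)) * r1.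
  rewrite (bigID (fun p => (p.1 \notin codom h) && (p.2 \notin codom h))) /= mulrC.
  congr (_ * _); last first.
    by apply: eq_bigr => p /andP[_ /andP[p1 p2]]; rewrite /F !glue_out.
  rewrite (bigID (fun p => (p.1 \in codom h) && (p.2 \in codom h))) /=; congr (_ * _).
    pose h2 (p : T' * T') := (h p.1, h p.2).
    have h2inj : injective h2 by move=> [a b] [c e] [/hinj -> /hinj ->].
    rewrite (eq_bigl (fun p => (p \in codom h2) && lt p.1 p.2)); last first.
      move=> [x y] /=.
      have -> : ((x, y) \in codom h2) = (x \in codom h) && (y \in codom h).
        apply/codomP/andP => [[[a b] [-> ->]]|[/codomP[a ->] /codomP[b ->]]].
          by rewrite !codom_f.
        by exists (a, b).
      by case: (lt x y); case: (x \in _); case: (y \in _).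
    rewrite big_codom // (eq_bigr (fun p => Ue (tau p.1) (tau p.2))); last first.
      by move=> p _; rewrite /F /= !glue_in.
    apply: (prod_orientation (F := fun p => Ue (tau p.1) (tau p.2))
              (r1 := fun a b => lt (h a) (h b))
              (r2 := fun a b => (enum_rank a < enum_rank b)%N && adjacent (pos' a) (pos' b))).
    - by move=> x y; apply: Ue_sym.
    - by move=> x y; apply: ltas.
    - by move=> x y /andP[xy _]; rewrite negb_and -leqNgt ltnW.
    move=> x y; rewrite ltadj !hpos [adjacent (pos' y) _]adjacentC.
    case: (ltngtP (enum_rank x) (enum_rank y)) => [||/ord_inj/enum_rank_inj ->] /=;
      by rewrite ?orbF ?adjacent_irrefl.
  pose c t := t \in codom h.
  rewrite (eq_bigl (fun p => lt p.1 p.2 && (c p.1 (+) c p.2))); last first.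
    by move=> p; rewrite /c; case: (lt _ _); case: (_ \in _); case: (_ \in _).
  rewrite (prod_orientation (r1 := fun x y => lt x y && (c x (+) c y))
     (r2 := fun x y => [&& adjacent (pos x) (pos y), c x & ~~ c y]) Fsym).
  - rewrite (eq_bigl (fun p => (c p.1 && predT p.1) &&
       (~~ c p.2 && adjacent (pos p.1) (pos p.2)))); last first.
      by move=> p /=; case: adjacent; case: (c _); case: (c _).
    rewrite -(pair_big_dep (fun x => c x && predT x)
      (fun x y => ~~ c y && adjacent (pos x) (pos y)) (fun x y => F (x, y))) /=.
    rewrite big_codom //; apply: eq_bigr => t _; rewrite big_mkcondr /=.
    by apply: eq_bigr => t0 t0h; rewrite hpos /F /= glue_in glue_out // Ue_sym.
  - by move=> x y /andP[/ltas/negPf ->].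
  - by move=> x y /and3P[_ -> /negPf ->]; rewrite /= andbF.
  move=> x y; rewrite [adjacent (pos y) _]adjacentC -ltadj.
  by case: (c x); case: (c y); rewrite /= ?andbF ?andbT ?orbF.
have bnd : \prod_v \prod_(i < d) \prod_(b : bool)
       (if boundary pos (nbr (pos v) i b) then
          (if psi (nbr (pos v) i b) is Some s then Ue s (om v) else 1)
        else 1) =
    (\prod_t \prod_(i < d) \prod_(b : bool)
       (if boundary pos (nbr (pos' t) i b) then
          (if psi (nbr (pos' t) i b) is Some s then Ue s (tau t) else 1)
        else 1)) * r2.
  rewrite (bigID (fun v => (v \in codom h) && predT v)) /= big_codom //; congr (_ * _).
    by apply: eq_bigr => t _; rewrite hpos glue_in.
  by apply: eq_big => [v|v]; rewrite andbT // => vh; rewrite glue_out.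
have vert : \prod_v Wv (om v) = (\prod_t Wv (tau t)) * r3.
  rewrite (bigID (fun v => (v \in codom h) && predT v)) /= big_codom //; congr (_ * _).
    by apply: eq_bigr => t _; rewrite glue_in.
  by apply: eq_big => [v|v]; rewrite andbT // => vh; rewrite glue_out.
have split_bnd : \prod_t \prod_(i < d) \prod_(b : bool)
       (if boundary pos' (nbr (pos' t) i b) then
          (if bc pos psi sigma (nbr (pos' t) i b) is Some s then Ue s (tau t) else 1)
        else 1) =
    (\prod_t \prod_(t0 | t0 \notin codom h)
       (if adjacent (pos' t) (pos t0) then Ue (sigma t0) (tau t) else 1)) *
    (\prod_t \prod_(i < d) \prod_(b : bool)
       (if boundary pos (nbr (pos' t) i b) then
          (if psi (nbr (pos' t) i b) is Some s then Ue s (tau t) else 1)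
        else 1)).
  rewrite -big_split; apply: eq_bigr => t _ /=.
  rewrite (eq_bigr (fun i => (\prod_(b : bool) \prod_(t0 : T | t0 \notin codom h)
     (if pos t0 == nbr (pos' t) i b then Ue (sigma t0) (tau t) else 1)) *
  (\prod_(b : bool) if boundary pos (nbr (pos' t) i b) then
      if psi (nbr (pos' t) i b) is Some s then Ue s (tau t) else 1 else 1))); last first.
  by move=> i _; rewrite -big_split; apply: eq_bigr => b _; rewrite boundary_factor.
rewrite big_split; congr (_ * _).
under eq_bigr => i _ do rewrite exchange_big.
  rewrite exchange_big; apply: eq_bigr => t0 _; exact: prod_nbr.
by rewrite /gibbs_weight [X in X * _ * _]edges bnd vert split_bnd; ring.
Qed.

End Subregion.
End Specification.

(** * Conditional expectation on a subregion *)

Section SpecificationOperator.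
Context (R : realFieldType) (d : nat) (S : finType) (Ue : S -> S -> R) (Wv : S -> R).
Context (Ue_ge0 : forall s t, 0 <= Ue s t) (Ue_sym : forall s t, Ue s t = Ue t s).
Context (Wv_gt0 : forall s, 0 < Wv s) (perm : permissive d Ue Wv).

Lemma partition_fn_gt0 (T : finType) (pos : T -> site d) psi :
  injective pos -> 0 < partition_fn Ue Wv pos psi.
Proof.
move=> /(perm psi)[sigma v]; rewrite lt_def partition_fn_ge0 // andbT.
by apply/eqP => Z0; move: v; rewrite /valid_cfg /gibbs Z0 invr0 mulr0 ltxx.
Qed.

Lemma sum_gibbs (T : finType) (pos : T -> site d) psi :
  injective pos -> \sum_sigma gibbs Ue Wv pos psi sigma = 1.
Proof. by move=> pinj; rewrite -mulr_suml mulfV // gt_eqF // partition_fn_gt0. Qed.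

(** The conditional expectation given the spins off the image of [h], written as resampling from the
    Gibbs measure of the subregion so that SSM applies to it directly. *)
Definition spec (T' T : finType) (pos' : T' -> site d) (pos : T -> site d) psi (h : T' -> T)
    (f : {ffun {ffun T -> S} -> R^o}) : {ffun {ffun T -> S} -> R^o} :=
  [ffun sigma => \sum_tau gibbs Ue Wv pos' (bc pos psi sigma) tau * f (glue h tau sigma)].

Section Subregion.
Context (T' T : finType) (pos' : T' -> site d) (pos : T -> site d) (h : T' -> T).
Context (hinj : injective h) (pinj : injective pos) (hpos : forall t, pos (h t) = pos' t).
Context (psi : site d -> option S).
Implicit Types (tau : {ffun T' -> S}) (sigma : {ffun T -> S}) (f g : {ffun {ffun T -> S} -> R^o}).

Let pinj' : injective pos' := pos'_inj hinj pinj hpos.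
Local Notation mu := (gibbs Ue Wv pos psi).
Local Notation P := (spec pos' pos psi h).

Lemma bc_local sigma sigma' w :
  (forall t, pos t = w -> sigma t = sigma' t) -> bc pos psi sigma w = bc pos psi sigma' w.
Proof. by rewrite /bc; case: pickP => // t /eqP <- ->. Qed.

Lemma gibbs_bc_local sigma sigma' tau :
  (forall t, boundary pos' (pos t) -> sigma t = sigma' t) ->
  gibbs Ue Wv pos' (bc pos psi sigma) tau = gibbs Ue Wv pos' (bc pos psi sigma') tau.
Proof.
by move=> e; apply: eq_gibbs => w bw; apply: bc_local => t tw; apply: e; rewrite tw.
Qed.

Lemma gibbs_bc_glue tau tau' sigma :
  gibbs Ue Wv pos' (bc pos psi (glue h tau' sigma)) tau =
  gibbs Ue Wv pos' (bc pos psi sigma) tau.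
Proof.
apply: gibbs_bc_local => t /andP[+ _]; rewrite (in_subregion pinj hpos) => th.
by rewrite glue_out.
Qed.

Lemma spec_glue f tau sigma : P f (glue h tau sigma) = P f sigma.
Proof.
by rewrite !ffunE; apply: eq_bigr => t _; rewrite gibbs_bc_glue glue_glue.
Qed.

Lemma spec_fix f : (forall tau sigma, f (glue h tau sigma) = f sigma) -> P f = f.
Proof.
move=> finv; apply/ffunP => sigma; rewrite ffunE.
under eq_bigr => tau _ do rewrite finv.
by rewrite -mulr_suml sum_gibbs // mul1r.
Qed.

(** Exchanging [tau] with the spins of [sigma] on the image of [h] is an involution on pairs, so
    each configuration arises equally often by gluing. *)
Lemma sum_glue (F : {ffun T -> S} -> R) :
  \sum_sigma \sum_tau F (glue h tau sigma) = #|{ffun T' -> S}|%:R * \sum_sigma F sigma.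
Proof.
pose phi (p : {ffun T -> S} * {ffun T' -> S}) := (glue h p.2 p.1, [ffun t => p.1 (h t)]).
have phiK : involutive phi.
  move=> [s t]; rewrite /phi /=; congr (_, _).
    by rewrite glue_glue // glue_restrict.
  by apply/ffunP => t'; rewrite ffunE glue_in.
rewrite pair_big /= (reindex_inj (inv_inj phiK)) /=.
rewrite (eq_bigr (fun p => F p.1)) => [|p _]; last first.
  by have := phiK p; rewrite {1}/phi /= => /(congr1 fst) /= ->.
rewrite -(pair_big predT predT (fun s (t : {ffun T' -> S}) => F s)) /= mulr_sumr.
by apply: eq_bigr => s _; rewrite sumr_const mulr_natl.
Qed.

(** The DLR equations: the Gibbs measure is a mixture of its resamplings. In the witness, the ratio
    of partition functions comes from [gibbs_weight_glue], and the division by the number of [tau]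
    undoes the multiplicity in [sum_glue]. *)
Lemma gibbs_disintegration :
  exists2 c : {ffun T -> S} -> R, (forall sigma, 0 <= c sigma) &
    forall F : {ffun T -> S} -> R, \sum_sigma mu sigma * F sigma =
      \sum_sigma c sigma *
        \sum_tau gibbs Ue Wv pos' (bc pos psi sigma) tau * F (glue h tau sigma).
Proof.
have [r r0 rE] := fin_all_exists2 (gibbs_weight_glue Ue_ge0 Ue_sym Wv_gt0 hinj pinj hpos psi).
have Z0 := partition_fn_gt0 psi pinj.
have [tg _] := perm psi pinj'.
have N0 : (#|{ffun T' -> S}|%:R : R) != 0.
  by rewrite pnatr_eq0 -lt0n; apply/card_gt0P; exists tg.
exists (fun s => r s * partition_fn Ue Wv pos' (bc pos psi s) / partition_fn Ue Wv pos psi /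
   #|{ffun T' -> S}|%:R) => [s|F].
  by rewrite !mulr_ge0 ?invr_ge0 ?partition_fn_ge0.
apply: (mulfI N0); rewrite -(sum_glue (fun s => mu s * F s)) mulr_sumr.
apply: eq_bigr => s _; have Z'0 := partition_fn_gt0 (bc pos psi s) pinj'.
rewrite /gibbs; move: (partition_fn _ _ pos' _) (partition_fn _ _ pos _) Z0 Z'0 => Z' Z Z0 Z'0.
rewrite !mulr_sumr; apply: eq_bigr => t _; rewrite rE.
by field; rewrite N0 !gt_eqF.
Qed.

Lemma spec_linear a f g : P (a *: f + g) = a *: P f + P g.
Proof.
apply/ffunP => s; rewrite !ffunE scaler_sumr -big_split /=; apply: eq_bigr => t _.
by rewrite !ffunE mulrDr; congr (_ + _); apply: mulrCA.
Qed.

(** For self-adjointness, [P f] and [P g] are constant under gluing, so after disintegration both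
    sides are the same mixture of products of local averages. *)
Lemma spec_projection : projection mu P.
Proof.
split; first exact: spec_linear.
  by move=> f; apply: spec_fix => tau sigma; apply: spec_glue.
move=> f g; have [c _ cE] := gibbs_disintegration; rewrite /dot !cE.
apply: eq_bigr => s _; congr (_ * _).
under eq_bigr => t _ do rewrite spec_glue mulrCA.
rewrite -mulr_sumr; under [RHS]eq_bigr => t _ do rewrite spec_glue mulrA.
by rewrite -mulr_suml !ffunE.
Qed.

Lemma spec_const a : P (finfun (fun=> a)) = finfun (fun=> a).
Proof. by apply: spec_fix => tau sigma; rewrite !ffunE. Qed.

End Subregion.

(** Disjoint, non-adjacent regions do not appear in each other's boundary condition. *)
Lemma spec_commute (T1 T2 T : finType) (pos1 : T1 -> site d) (pos2 : T2 -> site d)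
  (pos : T -> site d) psi (h1 : T1 -> T) (h2 : T2 -> T) f :
  injective h1 -> injective h2 -> injective pos ->
  (forall t, pos (h1 t) = pos1 t) -> (forall t, pos (h2 t) = pos2 t) ->
  (forall t1 t2, h1 t1 != h2 t2) ->
  (forall t1 t2, ~~ adjacent (pos1 t1) (pos2 t2)) ->
  spec pos1 pos psi h1 (spec pos2 pos psi h2 f) =
  spec pos2 pos psi h2 (spec pos1 pos psi h1 f).
Proof.
move=> inj1 inj2 pinj e1 e2 dis nadj; apply/ffunP => s; rewrite !ffunE.
have g1 t2 s' tau : gibbs Ue Wv pos1 (bc pos psi (glue h2 t2 s')) tau =
    gibbs Ue Wv pos1 (bc pos psi s') tau.
  apply: gibbs_bc_local => t /andP[_ /existsP[t1 a1]].
  rewrite glue_out //; apply/codomP => -[t' et]; move: a1.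
  by rewrite et e2 adjacentC (negPf (nadj _ _)).
have g2 t1 s' tau : gibbs Ue Wv pos2 (bc pos psi (glue h1 t1 s')) tau =
    gibbs Ue Wv pos2 (bc pos psi s') tau.
  apply: gibbs_bc_local => t /andP[_ /existsP[t2 a2]].
  rewrite glue_out //; apply/codomP => -[t' et]; move: a2.
  by rewrite et e1 (negPf (nadj _ _)).
have gg t1 t2 : glue h2 t2 (glue h1 t1 s) = glue h1 t1 (glue h2 t2 s).
  apply/ffunP => t; have [/codomP[u ->]|n1] := boolP (t \in codom h1).
    rewrite (glue_in inj1) glue_out ?glue_in //.
    by apply/codomP => -[u' /eqP]; rewrite (negPf (dis _ _)).
  rewrite [RHS]glue_out //; have [/codomP[u ->]|n2] := boolP (t \in codom h2).
    by rewrite !glue_in.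
  by rewrite !glue_out.
under eq_bigr => t1 _ do rewrite ffunE mulr_sumr.
under [RHS]eq_bigr => t2 _ do rewrite ffunE mulr_sumr.
rewrite exchange_big; apply: eq_bigr => t2 _; apply: eq_bigr => t1 _.
by rewrite g2 g1 gg mulrCA.
Qed.

End SpecificationOperator.

(** * A gap for a fixed finite region, uniform in the boundary condition *)

Section LocalGap.
Context (R : realFieldType).

(** Hard constraints allow zero weights; only the positive ones are bounded away from 0, a property
    stable under products. *)
Definition zero_or_within (m M x : R) : Prop := x = 0 \/ m <= x <= M.

Lemma zero_or_within_prod (I : finType) (P : pred I) (F : I -> R) (m M : R) :
  0 < m <= 1 -> 1 <= M -> (forall i, zero_or_within m M (F i)) ->
  zero_or_within (m ^+ #|I|) (M ^+ #|I|) (\prod_(i | P i) F i).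
Proof.
move=> /andP[m0 m1] M1 H.
have [/existsP[i /andP[Pi /eqP F0]]|/existsPn nz] := boolP [exists i, P i && (F i == 0)].
  by left; rewrite (bigD1 i) //= F0 mul0r.
right; rewrite big_mkcond /= -!prodr_const.
apply/andP; split; apply: ler_prod => i _.
  rewrite ltW //; case: ifP => // Pi.
  by case: (H i) => [F0|/andP[]//]; have := nz i; rewrite Pi F0 eqxx.
case: ifP => Pi; last by rewrite ler01.
case: (H i) => [F0|/andP[mF ->]//]; first by have := nz i; rewrite Pi F0 eqxx.
by rewrite (le_trans (ltW m0) mF).
Qed.

Lemma zero_or_within_mul m1 M1 m2 M2 x y : 0 < m1 -> 0 < m2 ->
  zero_or_within m1 M1 x -> zero_or_within m2 M2 y ->
  zero_or_within (m1 * m2) (M1 * M2) (x * y).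
Proof.
move=> p1 p2 [->|/andP[a b]]; first by left; rewrite mul0r.
move=> [->|/andP[c e]]; first by left; rewrite mulr0.
right; rewrite !ler_pM // ?(ltW p1) ?(ltW p2) //.
  exact: le_trans (ltW p1) a.
exact: le_trans (ltW p2) c.
Qed.

(** Since [0^-1 = 0], the zero values drop out of the sum of inverses that defines the lower
    bound. *)
Lemma finite_zero_or_within (I : finType) (F : I -> R) : (forall i, 0 <= F i) ->
  exists m M, [/\ 0 < m <= 1, 1 <= M & forall i, zero_or_within m M (F i)].
Proof.
move=> F0; exists (1 + \sum_i (F i)^-1)^-1, (1 + \sum_i F i).
have s0 : 0 <= \sum_i (F i)^-1 by apply: sumr_ge0 => i _; rewrite invr_ge0.
have p1 : 0 < 1 + \sum_i (F i)^-1 by rewrite ltr_pwDl.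
split=> [||i]; first by rewrite invr_gt0 p1 invf_le1 // lerDl.
  by rewrite lerDl sumr_ge0.
have [Fi0|Fi0] := eqVneq (F i) 0; first by left.
have Fp : 0 < F i by rewrite lt_def Fi0 F0.
right; apply/andP; split.
  rewrite -[F i]invrK lef_pV2 ?posrE ?invr_gt0 // (bigD1 i) //=.
  rewrite addrCA lerDl addr_ge0 // sumr_ge0 // => j _; by rewrite invr_ge0.
rewrite (bigD1 i) //= addrCA lerDl addr_ge0 // sumr_ge0 //.
Qed.

Context (d : nat) (S : finType) (Ue : S -> S -> R) (Wv : S -> R).
Context (Ue_ge0 : forall s t, 0 <= Ue s t) (Ue_sym : forall s t, Ue s t = Ue t s).
Context (Wv_gt0 : forall s, 0 < Wv s) (perm : permissive d Ue Wv).
Context (irred : glauber_irreducible d Ue Wv).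

(** Uniform over positions and boundary conditions because every weight is a product of boundedly
    many factors from a finite list: 1, [Ue s t], [Wv s]. *)
Lemma gibbs_lower_bound (T : finType) :
  exists2 eps : R, 0 < eps & forall (pos : T -> site d) psi sigma, injective pos ->
    valid_cfg Ue Wv pos psi sigma -> eps <= gibbs Ue Wv pos psi sigma.
Proof.
pose F (x : option (S * S + S)) : R :=
  match x with Some (inl p) => Ue p.1 p.2 | Some (inr s) => Wv s | None => 1 end.
have F0 x : 0 <= F x by case: x => [[p|s]|] //=; apply: ltW.
have [m [M [m01 M1 H]]] := finite_zero_or_within F0.
have {}H x y : zero_or_within m M (Ue x y) /\ zero_or_within m M (Wv x) /\ zero_or_within m M 1.
  by split; [exact: (H (Some (inl (x, y))))|split; [exact: (H (Some (inr x)))|exact: (H None)]].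
have pw k : 0 < m ^+ k <= 1 /\ 1 <= M ^+ k.
  have /andP[m0 m1] := m01; rewrite exprn_gt0 // exprn_ile1 ?(ltW m0) //.
  by rewrite exprn_ege1.
pose N := (#|{: T * T}| + #|{: bool}| * #|'I_d| * #|T| + #|T|)%N.
have wgood (pos : T -> site d) psi (sigma : {ffun T -> S}) :
    zero_or_within (m ^+ N) (M ^+ N) (gibbs_weight Ue Wv pos psi sigma).
  have g1 (v : T) : zero_or_within m M 1 by have [_ []] := H (sigma v) (sigma v).
  rewrite /gibbs_weight /N !exprD !exprM; have m0 : 0 < m by case/andP: m01.
  have pm k1 k2 k3 : 0 < ((m ^+ k1) ^+ k2) ^+ k3 by rewrite !exprn_gt0.
  apply: zero_or_within_mul; rewrite ?mulr_gt0 ?exprn_gt0 //; last first.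
    by apply: zero_or_within_prod => // v; have [_ []] := H (sigma v) (sigma v).
  apply: zero_or_within_mul; rewrite ?exprn_gt0 //.
    apply: zero_or_within_prod => // p.
    by have [] := H (sigma p.1) (sigma p.2).
  apply: zero_or_within_prod => [||v]; first by rewrite -exprM (pw _).1.
    by rewrite -exprM (pw _).2.
  apply: zero_or_within_prod => [||i]; [by rewrite (pw _).1|by rewrite (pw _).2|].
  apply: zero_or_within_prod => // b.
  by case: ifP => _; [case: (psi _) => [s|]|]; [have [] := H s (sigma v)|apply: g1|apply: g1].
have mN := pw N; set m' := m ^+ N in mN wgood *; set M' := M ^+ N in mN wgood *.
case: mN => /andP[m0 _] M'1.
have M'0 : 0 < M' by apply: lt_le_trans M'1.
exists (m' / ((#|{ffun T -> S}|%:R + 1) * M')) => [|pos psi sigma pinj].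
  by rewrite divr_gt0 // mulr_gt0 // ltr_wpDl.
rewrite /valid_cfg /gibbs; have Z0 := partition_fn_gt0 Ue_ge0 Wv_gt0 perm psi pinj.
rewrite pmulr_lgt0 ?invr_gt0 // => w0.
have wm : m' <= gibbs_weight Ue Wv pos psi sigma.
  by case: (wgood pos psi sigma) => [w|/andP[]//]; rewrite w ltxx in w0.
have ZM : partition_fn Ue Wv pos psi <= (#|{ffun T -> S}|%:R + 1) * M'.
  rewrite mulrDl mul1r; apply: ler_wpDr; first exact: ltW.
  rewrite mulr_natl -sumr_const; apply: ler_sum => s _.
  by case: (wgood pos psi s) => [->|/andP[]//]; apply: ltW.
have K0 : 0 < (#|{ffun T -> S}|%:R + 1) * M' by rewrite mulr_gt0 // ltr_wpDl.
by apply: ler_pM => //; rewrite ?invr_ge0 ?lef_pV2 // ltW.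
Qed.

Lemma variance_le (X : finType) (nu : X -> R) (g : X -> R) c :
  (forall x, 0 <= nu x) -> \sum_x nu x = 1 ->
  \sum_x nu x * (g x - \sum_y nu y * g y) ^+ 2 <= \sum_x nu x * (g x - c) ^+ 2.
Proof.
move=> nu0 nu1; set a := \sum_y nu y * g y.
have E e : \sum_x nu x * (g x - e) ^+ 2 = \sum_x nu x * g x ^+ 2 - 2 * e * a + e ^+ 2.
  have -> : e ^+ 2 = \sum_x nu x * e ^+ 2 by rewrite -mulr_suml nu1 mul1r.
  rewrite /a mulr_sumr -sumrN -!big_split /=.
  apply: eq_bigr => x _; ring.
by rewrite !E; have := sqr_ge0 (a - c); lra.
Qed.

Lemma glauber_step (T : finType) (pos : T -> site d) psi sigma tau :
  0 < block_kernel Ue Wv pos psi (fun v : T => [set v]) sigma tau ->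
  exists v, forall t, t != v -> sigma t = tau t.
Proof.
move=> k0; have [v vP|nov] := pickP (fun v => [forall x in ~: [set v], sigma x == tau x]).
  exists v => t tv; apply/eqP; move/forall_inP: vP; apply; by rewrite !inE.
move: k0; rewrite /block_kernel big1 ?mulr0 ?ltxx // => v _.
by rewrite nov.
Qed.

(** [k v] is any function blind to the spin at [v], not only a conditional expectation, so that site
    updates computed in a larger region can be inserted. *)
Definition has_local_gap (T : finType) (K : R) : Prop :=
  forall (pos : T -> site d) psi, injective pos ->
    forall (g : {ffun T -> S} -> R) (k : T -> {ffun T -> S} -> R),
    (forall v (sigma tau : {ffun T -> S}), (forall t, t != v -> sigma t = tau t) ->
      k v sigma = k v tau) ->
    let nu := gibbs Ue Wv pos psi in
    \sum_sigma nu sigma * (g sigma - \sum_tau nu tau * g tau) ^+ 2 <=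
    K * \sum_v \sum_sigma nu sigma * (g sigma - k v sigma) ^+ 2.

(** Irreducibility joins valid configurations by single-site changes. Both ends of a change at [v]
    share the value of [k v] and are close to it, because each has mass at least [eps] in the local
    variance. *)
Lemma local_gap (T : finType) : exists2 K : R, 0 <= K & has_local_gap T K.
Proof.
have [eps e0 epsP] := gibbs_lower_bound T.
(* 4/eps times the total local variance bounds one squared change; a factor 4 is lost per step, and
   a simple path is no longer than the number of configurations. *)
exists (4 ^+ #|{ffun T -> S}| * (4 / eps)).
  by rewrite mulr_ge0 ?exprn_ge0 // divr_ge0 // ltW.
move=> pos psi pinj g k kinv; set nu := gibbs _ _ _ _ => /=.
set D := \sum_v \sum_s nu s * (g s - k v s) ^+ 2; set B := 4 / eps * D; rewrite -mulrA -/B.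
have nu0 s : 0 <= nu s by apply: gibbs_ge0.
have nu1 : \sum_s nu s = 1 by apply: sum_gibbs.
have D0 : 0 <= D.
  by do 2 (apply: sumr_ge0 => ? _); rewrite mulr_ge0 // sqr_ge0.
have B0 : 0 <= B by rewrite mulr_ge0 // divr_ge0 // ltW.
have dev v s : valid_cfg Ue Wv pos psi s -> (g s - k v s) ^+ 2 <= D / eps.
  move=> vs; rewrite ler_pdivlMr // mulrC.
  have -> : D = nu s * (g s - k v s) ^+ 2 +
     (\sum_(t | t != s) nu t * (g t - k v t) ^+ 2 +
      \sum_(u | u != v) \sum_t nu t * (g t - k u t) ^+ 2).
    by rewrite /D (bigD1 v) //= (bigD1 s) //= addrA.
  apply: ler_wpDr; last by rewrite ler_wpM2r ?sqr_ge0 // epsP.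
  rewrite addr_ge0 //; last apply: sumr_ge0 => u _; apply: sumr_ge0 => t _;
    by rewrite mulr_ge0 // sqr_ge0.
pose Om : finType := {s : {ffun T -> S} | valid_cfg Ue Wv pos psi s}.
have along (x : Om) p : path (fun a b : Om => 0 < block_kernel Ue Wv pos psi
    (fun v : T => [set v]) (val a) (val b)) x p ->
    (g (val (last x p)) - g (val x)) ^+ 2 <= 4 ^+ size p * B.
  elim: p x => [|y p IH] x /=; first by rewrite subrr expr0n mul1r.
  move=> /andP[/glauber_step[v xy] /IH]; set a := g (val (last _ _)) => {}IH.
  have dx := dev v _ (valP x); have dy := dev v _ (valP y).
  rewrite (kinv v _ _ xy) in dx.
  have q1 := sqr_ge0 (g (val x) - k v (val y) + (g (val y) - k v (val y))).
  have q2 := sqr_ge0 ((a - g (val y)) - (g (val y) - g (val x))).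
  have step : (g (val y) - g (val x)) ^+ 2 <= B.
    by rewrite /B mulrAC -mulrA; move: dx dy q1; nra.
  have e1 : 1 <= (4 : R) ^+ size p by apply: exprn_ege1; lra.
  have : (a - g (val x)) ^+ 2 <= 2 * (a - g (val y)) ^+ 2 + 2 * (g (val y) - g (val x)) ^+ 2.
    by move: q2; nra.
  have := ler_peMl B0 e1; rewrite [4 ^+ _.+1]exprS -mulrA => e2.
  by move/le_trans; apply; lra.
have [s0 v0] := perm psi pinj.
apply: le_trans (variance_le g (g s0) nu0 nu1) _.
have -> : 4 ^+ #|{ffun T -> S}| * B = \sum_s nu s * (4 ^+ #|{ffun T -> S}| * B).
  by rewrite -mulr_suml nu1 mul1r.
apply: ler_sum => s _.
have := nu0 s; rewrite le_eqVlt => /orP[/eqP <-|vs]; first by rewrite !mul0r.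
rewrite ler_pM2l //.
have /connectP[p pp sE] := irred pinj (exist _ s0 v0 : Om) (exist _ s vs : Om).
case/shortenP: pp sE => p' pp' up' _ /(congr1 val) /= ->.
apply: le_trans (along _ _ pp') _; rewrite ler_wpM2r //.
apply: ler_weXn2l; first lra.
have := card_uniqP up' => /= sz.
apply: ltnW; rewrite -sz; apply: leq_trans (max_card _) _.
by rewrite card_sig; apply: max_card.
Qed.

End LocalGap.

(** * Lipschitz functions and the effect of one disagreement *)

Section Lipschitz.
Context (R : realFieldType) (T S : finType).

Definition lipschitz (f : {ffun T -> S} -> R) (Dl : R) : Prop :=
  forall v (sigma tau : {ffun T -> S}), (forall t, t != v -> sigma t = tau t) ->
    `|f sigma - f tau| <= Dl.

Lemma lipschitz_seq f Dl (s : seq T) (sigma tau : {ffun T -> S}) :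
  lipschitz f Dl -> (forall t, t \notin s -> sigma t = tau t) ->
  `|f sigma - f tau| <= (size s)%:R * Dl.
Proof.
move=> lf; elim: s sigma => [|v s IH] sigma e /=.
  have -> : sigma = tau by apply/ffunP => t; apply: e.
  by rewrite subrr normr0 mul0r.
pose om := [ffun t => if t == v then tau t else sigma t].
rewrite -natr1 mulrDl mul1r [X in _ <= X]addrC.
rewrite -[f sigma](subrK (f om)) -addrA (le_trans (ler_normD _ _)) // lerD //.
  by apply: (lf v) => t tv; rewrite ffunE (negPf tv).
apply: IH => t ts; rewrite ffunE; case: eqP => // /eqP tv.
by apply: e; rewrite in_cons negb_or tv.
Qed.

Lemma lipschitz_set f Dl (A : {set T}) (sigma tau : {ffun T -> S}) :
  lipschitz f Dl -> (forall t, t \notin A -> sigma t = tau t) ->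
  `|f sigma - f tau| <= #|A|%:R * Dl.
Proof.
move=> lf e; rewrite cardE; apply: lipschitz_seq => // t.
by rewrite mem_enum; apply: e.
Qed.

Lemma lipschitz_osc f Dl (sigma tau : {ffun T -> S}) :
  lipschitz f Dl -> `|f sigma - f tau| <= #|T|%:R * Dl.
Proof.
move=> lf; rewrite -cardsT; apply: lipschitz_set => // t; by rewrite inE.
Qed.

End Lipschitz.

Section SpecLipschitz.
Context (R : realFieldType) (d : nat) (S : finType) (Ue : S -> S -> R) (Wv : S -> R).
Context (Ue_ge0 : forall s t, 0 <= Ue s t) (Ue_sym : forall s t, Ue s t = Ue t s).
Context (Wv_gt0 : forall s, 0 < Wv s) (perm : permissive d Ue Wv).
Context (T' T : finType) (pos' : T' -> site d) (pos : T -> site d) (h : T' -> T).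
Context (hinj : injective h) (pinj : injective pos) (hpos : forall t, pos (h t) = pos' t).
Context (psi : site d -> option S).
Let pinj' : injective pos' := pos'_inj hinj pinj hpos.
Local Notation P := (spec Ue Wv pos' pos psi h).

Section Disagreement.
Context (f : {ffun {ffun T -> S} -> R^o}) (Dl : R) (lf : lipschitz f Dl).
Context (u : T) (sigma sigma' : {ffun T -> S}) (e : forall t, t != u -> sigma t = sigma' t).

Lemma spec_lipschitz_in : u \in codom h -> P f sigma = P f sigma'.
Proof.
move=> uh; rewrite !ffunE; apply: eq_bigr => tau _; congr (_ * f _).
  apply: gibbs_bc_local => t /andP[]; rewrite (in_subregion pinj hpos) => th _.
  by apply: e; apply: contraNneq th => ->.
apply/ffunP => t; have [/codomP[t' ->]|th] := boolP (t \in codom h).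
  by rewrite !glue_in.
by rewrite !glue_out //; apply: e; apply: contraNneq th => ->.
Qed.

Let glue_diff tau : `|f (glue h tau sigma) - f (glue h tau sigma')| <= Dl.
Proof.
apply: (lf (v := u)) => t tu; have [/codomP[t' ->]|th] := boolP (t \in codom h).
  by rewrite !glue_in.
by rewrite !glue_out // e.
Qed.

Let avg_diff psi' : `|\sum_tau gibbs Ue Wv pos' psi' tau *
   (f (glue h tau sigma) - f (glue h tau sigma'))| <= Dl.
Proof.
apply: le_trans (ler_norm_sum _ _ _) _.
have -> : Dl = \sum_tau gibbs Ue Wv pos' psi' tau * Dl.
  by rewrite -mulr_suml (sum_gibbs Ue_ge0 Wv_gt0 perm) // mul1r.
apply: ler_sum => tau _; rewrite normrM ger0_norm ?gibbs_ge0 //.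
by rewrite ler_wpM2l ?gibbs_ge0.
Qed.

(** The law of the resampled spins is the same on both sides, so at most the discrepancy at [u]
    survives. *)
Lemma spec_lipschitz_far : ~~ boundary pos' (pos u) -> `|P f sigma - P f sigma'| <= Dl.
Proof.
move=> nb; rewrite !ffunE.
under [X in _ - X]eq_bigr => tau _.
  rewrite -(gibbs_bc_local Ue Wv psi (sigma := sigma)); first over.
  by move=> t bt; apply: e; apply: contraNneq nb => <-.
rewrite -sumrB; under eq_bigr => tau _ do rewrite -mulrBr.
exact: avg_diff.
Qed.

(** One [Dl] pays for the discrepancy at [u]. Replacing [f] by a function of the spins in [B] alone
    costs [#|~: B| * Dl] under each of the two laws; that function deviates by at most [#|B| * Dl]
    from a constant, so the total variation bound costs 2 eta times this. *)
Lemma spec_lipschitz_boundary (B : {set T'}) (eta : R) :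
  tv_marginal Ue Wv pos' (bc pos psi sigma) (bc pos psi sigma') B <= eta ->
  `|P f sigma - P f sigma'| <= Dl * (1 + 2 * #|~: B|%:R + 2 * #|B|%:R * eta).
Proof.
move=> tvle; set nu := gibbs Ue Wv pos' (bc pos psi sigma).
set nu' := gibbs Ue Wv pos' (bc pos psi sigma').
have Dl0 : 0 <= Dl by apply: le_trans (glue_diff [ffun t => sigma (h t)]).
have nu0 t : 0 <= nu t by apply: gibbs_ge0.
have nu'0 t : 0 <= nu' t by apply: gibbs_ge0.
have nu1 : \sum_t nu t = 1 by apply: sum_gibbs.
have nu'1 : \sum_t nu' t = 1 by apply: sum_gibbs.
pose g tau : R := f (glue h tau sigma).
have lg : lipschitz g Dl.
  move=> v s t st; apply: (lf (v := h v)) => w wv.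
  have [/codomP[w' wE]|wh] := boolP (w \in codom h); last by rewrite !glue_out.
  by rewrite wE !glue_in // st //; apply: contraNneq wv => <-; rewrite wE.
pose tau0 : {ffun T' -> S} := [ffun t => sigma (h t)].
pose restr (tau : {ffun T' -> S}) : {ffun {x : T' | x \in B} -> S} := [ffun x => tau (val x)].
(* [G] freezes the spins off [B] to [tau0]. *)
pose G (eta' : {ffun {x : T' | x \in B} -> S}) : R := g (glue val eta' tau0).
have codB t : (t \in codom (val : {x : T' | x \in B} -> T')) = (t \in B).
  apply/codomP/idP => [[x ->]|tB]; first exact: valP.
  by exists (exist _ t tB).
have gG tau : `|g tau - G (restr tau)| <= #|~: B|%:R * Dl.
  apply: (lipschitz_set lg) => t; rewrite inE negbK => tB.
  have -> : t = val (exist _ t tB : {x : T' | x \in B}) by [].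
  by rewrite glue_in ?ffunE //; apply: val_inj.
have Gg eta' : `|G eta' - g tau0| <= #|B|%:R * Dl.
  apply: (lipschitz_set lg) => t tB; rewrite glue_out //.
  by rewrite codB.
have marg m psi' : m =1 gibbs Ue Wv pos' psi' ->
    \sum_tau m tau * (G (restr tau) - g tau0) =
    \sum_eta' marginal Ue Wv pos' psi' eta' * (G eta' - g tau0).
  move=> mE; rewrite (partition_big restr predT) //=; apply: eq_bigr => eta' _.
  rewrite /marginal mulr_suml; apply: eq_big => [tau|tau /eqP <-]; last by rewrite mE.
  apply/eqP/forallP => [<- x|H]; first by rewrite ffunE.
  by apply/ffunP => x; rewrite ffunE; apply/eqP.
have tvB : `|\sum_tau nu tau * (G (restr tau) - g tau0) -
    \sum_tau nu' tau * (G (restr tau) - g tau0)| <= 2 * eta * (#|B|%:R * Dl).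
  rewrite (marg nu (bc pos psi sigma)) // (marg nu' (bc pos psi sigma')) // -sumrB.
  apply: le_trans (ler_norm_sum _ _ _) _.
  apply: (@le_trans _ _ (2 * tv_marginal Ue Wv pos' (bc pos psi sigma) (bc pos psi sigma') B *
     (#|B|%:R * Dl))); last by rewrite ler_wpM2r ?mulr_ge0 // ler_wpM2l.
  rewrite /tv_marginal [2 * _]mulrA mulfV ?pnatr_eq0 // mul1r mulr_suml; apply: ler_sum => eta' _.
  by rewrite -mulrBl normrM ler_wpM2l.
have dif (m : {ffun T' -> S} -> R) : (forall t, 0 <= m t) -> \sum_t m t = 1 ->
    `|\sum_tau m tau * (g tau - G (restr tau))| <= #|~: B|%:R * Dl.
  move=> m0 m1; apply: le_trans (ler_norm_sum _ _ _) _.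
  have -> : #|~: B|%:R * Dl = \sum_t m t * (#|~: B|%:R * Dl) by rewrite -mulr_suml m1 mul1r.
  by apply: ler_sum => tau _; rewrite normrM ger0_norm // ler_wpM2l.
have E (m : {ffun T' -> S} -> R) : \sum_t m t = 1 ->
    \sum_tau m tau * g tau = \sum_tau m tau * (g tau - G (restr tau)) +
      \sum_tau m tau * (G (restr tau) - g tau0) + g tau0.
  move=> m1; have e0 : g tau0 = \sum_t m t * g tau0 by rewrite -mulr_suml m1 mul1r.
  rewrite [X in _ = _ + X]e0.
  by rewrite -!big_split /=; apply: eq_bigr => tau _; ring.
have d1 := avg_diff (bc pos psi sigma').
have d2 := dif _ nu0 nu1; have d3 := dif _ nu'0 nu'1.
rewrite !ffunE -/nu -/nu' -/(g).
have -> : \sum_tau nu' tau * f (glue h tau sigma') = \sum_tau nu' tau * g tau -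
    \sum_tau nu' tau * (f (glue h tau sigma) - f (glue h tau sigma')).
  by rewrite -sumrB; apply: eq_bigr => tau _; rewrite /g; ring.
rewrite -/nu' in d1.
have -> : \sum_tau nu tau * f (glue h tau sigma) = \sum_tau nu tau * g tau by [].
rewrite (E nu) // (E nu') //.
move: d1 d2 d3 tvB; rewrite !ler_norml => /andP[a1 b1] /andP[a2 b2] /andP[a3 b3] /andP[a4 b4].
apply/andP; split; lra.
Qed.

End Disagreement.
End SpecLipschitz.

(** * Weighted windows and subcubes *)

Local Open Scope nat_scope.

Section WindowWeights.
Context (q l L : nat) (q0 : 0 < q) (lq : l = q * q) (lL : 2 * l <= L).

(* Windows [x, x+l) inside [0, L); the two extreme ones get the extra weight [q], so that
   every site is covered with weight [q] at least while being a window boundary is [q]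
   times less likely than being covered. *)
Definition window_weight (x : nat) : nat := if (x == 0) || (x == L - l) then q else 1.
Definition window (x y : nat) : bool := x <= y < x + l.
Definition window_edge (x y : nat) : bool := (x == y.+1) || (y == x + l).
Definition coverage (y : nat) : nat :=
  \sum_(x < (L - l).+1) (if window x y then window_weight x else 0).
Definition edge_coverage (y : nat) : nat :=
  \sum_(x < (L - l).+1) (if window_edge x y then window_weight x else 0).

Let l0 : 0 < l. Proof. by rewrite lq muln_gt0 q0. Qed.

Lemma window_weight_gt0 x : 0 < window_weight x.
Proof. by rewrite /window_weight; case: ifP. Qed.

Lemma window_weight_le x : window_weight x <= q.
Proof. by rewrite /window_weight; case: ifP. Qed.

Lemma coverage_ge_weight x y : x <= L - l -> window x y -> window_weight x <= coverage y.
Proof.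
rewrite -ltnS => xN xy; rewrite /coverage (bigD1 (Ordinal xN)) //= xy.
exact: leq_addr.
Qed.

(** All [l] windows starting in [y + 1 - l, y] are available. *)
Lemma coverage_ge_bulk y : l <= y.+1 -> y <= L - l -> l <= coverage y.
Proof.
move=> ly yL; rewrite -[X in X <= _](addKn (y.+1 - l)) -[X in X <= _]muln1.
rewrite -sum_nat_const_nat subnK // (big_nat_widen _ _ (L - l).+1) //.
rewrite (big_nat_widenl _ 0) // big_mkord big_mkcond; apply: leq_sum => x _.
case: ifP => //= H; rewrite /window ifT ?window_weight_gt0 //; lia.
Qed.

(** Near an end the extreme window suffices by its weight [q]; elsewhere the bulk bound gives even
    [l = q * q]. *)
Lemma coverage_ge y : y < L -> q <= coverage y.
Proof.
move=> yL.
have [yl|yl] := ltnP y l.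
  by apply: leq_trans (coverage_ge_weight (x := 0) _ _); rewrite /window_weight /window.
have [yr|yr] := ltnP y (L - l); last first.
  apply: leq_trans (coverage_ge_weight (x := L - l) _ _) => //.
    by rewrite /window_weight eqxx orbT.
  by rewrite /window; lia.
apply: (@leq_trans l); first by rewrite lq leq_pmulr.
by apply: coverage_ge_bulk; lia.
Qed.

Let sum_single (z : nat) (F : nat -> nat) (b : nat) : (z <= L - l -> F z <= b) ->
  \sum_(x < (L - l).+1) (if x == z :> nat then F x else 0) <= b.
Proof.
move=> H; rewrite -big_mkcond /=; have [zL|zL] := leqP z (L - l); last first.
  by rewrite big_pred0 // => x; have := ltn_ord x; lia.
by rewrite (big_pred1 (Ordinal (zL : z < (L - l).+1))) /= ?H.
Qed.

(** At most two windows touch [y] from outside, starting at y + 1 or at y - l. For one of weight 1,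
    [q <= coverage y] is enough; an extreme one of weight [q] touches only bulk sites, whose
    coverage is at least [l = q * q]. *)
Lemma edge_coverage_le y : y < L -> q * edge_coverage y <= 2 * coverage y.
Proof.
move=> yL; have qc := coverage_ge yL.
pose G1 := \sum_(x < (L - l).+1) (if x == y.+1 :> nat then q * window_weight x else 0).
pose G2 := \sum_(x < (L - l).+1)
  (if x == y - l :> nat then (if l <= y then q * window_weight x else 0) else 0).
apply: (@leq_trans (G1 + G2)).
  rewrite big_distrr -big_split; apply: leq_sum => x _ /=; rewrite /window_edge.
  case: (eqVneq (x : nat) y.+1) => [->|n1] /=; first by rewrite leq_addr.
  case: eqP => [->|_]; last by rewrite muln0.
  by rewrite addnK eqxx leq_addl.
rewrite mul2n -addnn leq_add //.
  apply: (sum_single (F := fun x => q * window_weight x)) => H.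
  rewrite /window_weight /=; case: eqP => [H'|_]; last by rewrite muln1.
  by rewrite -lq; apply: coverage_ge_bulk; lia.
apply: (sum_single (F := fun x => if l <= y then q * window_weight x else 0)) => H.
case: ifP => // ly; rewrite /window_weight.
case: eqP => [H'|_] /=; last by case: eqP => [H''|_]; [lia|rewrite muln1].
by rewrite -lq; apply: coverage_ge_bulk; lia.
Qed.

Lemma coverage_le y : coverage y <= l * q.
Proof.
rewrite /coverage -big_mkcond /=; apply: leq_trans; first by apply: leq_sum => x _; exact: window_weight_le.
rewrite sum_nat_const leq_mul2r; apply/orP; right.
rewrite -[X in _ <= X](prednK l0) -[X in _ <= X]card_ord.
rewrite -cardsE -(card_in_imset (f := fun x : 'I_(L - l).+1 => inord (y - x) : 'I_l.-1.+1)).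
  exact: max_card.
move=> x x'; rewrite !inE /window => wx wx' /(congr1 val) /=.
by rewrite !inordK ?prednK //; [move=> e; apply: val_inj; rewrite /=; lia|lia|lia].
Qed.

End WindowWeights.

Section SubcubeWeights.
Context (d q l L : nat) (q0 : 0 < q) (lq : l = q * q) (lL : 2 * l <= L).

Definition starts := {ffun 'I_d -> 'I_(L - l).+1}.
Definition subcube_weight (x : starts) : nat := \prod_i window_weight q l L (x i).
Definition in_subcube (x : starts) (v : cube d L) : bool := [forall i, window l (x i) (v i)].
(** The outer boundary of the subcube: one step outside in one coordinate, inside in all others. *)
Definition near_subcube (x : starts) (v : cube d L) : bool :=
  [exists i, window_edge l (x i) (v i) && [forall j, (j != i) ==> window l (x j) (v j)]].

Lemma sum_in_subcube v : \sum_(x | in_subcube x v) subcube_weight x =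
  \prod_i coverage q l L (v i).
Proof.
rewrite bigA_distr_bigA /= big_mkcond; apply: eq_bigr => x _.
case: ifPn => [/forallP H|]; first by apply: eq_bigr => i _; rewrite H.
by case/forallPn => i /negPf H; rewrite (bigD1 i) //= H.
Qed.

(** A union bound over the coordinate that sticks out; for fixed coordinate the sum factors, and
    [edge_coverage_le] compares the one exceptional factor. *)
Lemma sum_near_subcube v :
  q * (\sum_(x | near_subcube x v) subcube_weight x) <= 2 * d * \prod_i coverage q l L (v i).
Proof.
pose E (x : starts) i j := if (if j == i then window_edge l (x j) (v j) else window l (x j) (v j))
  then window_weight q l L (x j) else 0.
apply: (@leq_trans (q * \sum_(i < d) \sum_(x : starts) \prod_j E x i j)).
  rewrite leq_mul2l exchange_big big_mkcond; apply/orP; right; apply: leq_sum => x _ /=.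
  case: ifP => // /existsP[i /andP[xe /forallP xw]].
  rewrite (bigD1 i) //=; apply: leq_trans (leq_addr _ _); apply: eq_leq.
  apply: eq_bigr => j _; rewrite /E; case: eqP => [->|/eqP ji]; first by rewrite xe.
  by have := xw j; rewrite ji /= => ->.
rewrite big_distrr /= [2 * d]mulnC -mulnA -[X in _ <= X * _](card_ord d) -sum_nat_const.
apply: leq_sum => i _.
rewrite (_ : \sum_x _ = edge_coverage q l L (v i) * \prod_(j | j != i) coverage q l L (v j)).
  rewrite [X in _ <= _ * X](bigD1 i) //= !mulnA leq_mul2r; apply/orP; right.
  by apply: edge_coverage_le => //; apply: ltn_ord.
transitivity (\prod_j (if j == i then edge_coverage q l L (v j) else coverage q l L (v j))).
  rewrite (eq_bigr (fun j => \sum_(k < (L - l).+1)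
    (if (if j == i then window_edge l k (v j) else window l k (v j))
     then window_weight q l L k else 0))); last first.
    by move=> j _; case: eqP.
  by rewrite bigA_distr_bigA.
by rewrite (bigD1 i) //= eqxx; congr (_ * _); apply: eq_bigr => j /negPf ->.
Qed.

End SubcubeWeights.

Local Close Scope nat_scope.
Local Open Scope ring_scope.

(** * Geometry of subcubes *)

Lemma cube_pos_inj d L (a : site d) : injective (cube_pos (L := L) a).
Proof.
move=> v w e; apply/ffunP => i; apply: val_inj => /=.
have := congr1 (fun f : site d => f i) e; rewrite !ffunE => /addrI.
by case.
Qed.

Section Subcube.
Context (d l L : nat) (lL : (l <= L)%N) (a : site d).
Implicit Types (x : starts d l L) (v : cube d L) (y : cube d l).

Lemma subcube_ltn x y i : (x i + y i < L)%N.
Proof. have := ltn_ord (x i); have := ltn_ord (y i); lia. Qed.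

Definition subcube_map x (y : cube d l) : cube d L := [ffun i => Ordinal (subcube_ltn x y i)].
Definition subcube_origin x : site d := [ffun i => a i + (x i : nat)%:Z].

Lemma subcube_map_inj x : injective (subcube_map x).
Proof.
move=> v w e; apply/ffunP => i; apply: val_inj => /=.
have := congr1 (fun f : cube d L => val (f i)) e; rewrite !ffunE /=; lia.
Qed.

Lemma subcube_mapE x y : cube_pos a (subcube_map x y) = cube_pos (subcube_origin x) y.
Proof. by apply/ffunP => i; rewrite !ffunE /= PoszD addrA. Qed.

Lemma in_subcubeE x v : in_subcube x v = (v \in codom (subcube_map x)).
Proof.
apply/forallP/codomP => [H|[y -> i]]; last first.
  by rewrite /window ffunE /= leq_addr ltn_add2l ltn_ord.
have lt i : (v i - x i < l)%N by have := H i; rewrite /window; lia.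
exists [ffun i => Ordinal (lt i)]; apply/ffunP => i; apply: val_inj.
by rewrite !ffunE /= ffunE /= subnKC //; case/andP: (H i).
Qed.

Lemma boundary_near_subcube x v :
  boundary (cube_pos (L := l) (subcube_origin x)) (cube_pos a v) -> near_subcube x v.
Proof.
move=> /andP[nin /existsP[y]]; rewrite adjacentC => /adjacentP[i [b e]].
have {}nin : ~~ in_subcube x v.
  apply: contra nin; rewrite in_subcubeE => /codomP[z ->]; apply/existsP; exists z.
  by rewrite subcube_mapE.
have ei j : (v j : nat)%:Z = (x j : nat)%:Z + (y j : nat)%:Z +
    (if j == i then if b then 1 else -1 else 0).
  have := congr1 (fun f : site d => f j) e; rewrite !ffunE.
  move: (a j) (v j : nat)%:Z (x j : nat)%:Z (y j : nat)%:Z => A B C D {e nin}.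
  by case: eqP => _; case: (b); lia.
have out j : j != i -> window l (x j) (v j).
  move=> ji; have := ei j; rewrite (negPf ji) addr0 /window; have := ltn_ord (y j); lia.
apply/existsP; exists i; apply/andP; split; last first.
  by apply/forallP => j; apply/implyP; apply: out.
have wi : ~~ window l (x i) (v i).
  apply: contra nin => wi; apply/forallP => j.
  by have [->//|/out] := eqVneq j i.
move: wi (ei i); rewrite eqxx /window /window_edge; have := ltn_ord (y i).
by case: b {e ei}; lia.
Qed.

End Subcube.

(** Each coordinate offset from [u] lies strictly between -m and m; shifted by m it is a natural
    number below 2m. *)
Lemma card_near_site d l (a u : site d) m : (0 < m)%N ->
  (#|[set w : cube d l | (l1dist u (cube_pos a w) < m)%N]| <= (2 * m) ^ d)%N.
Proof.
move=> m0.
pose f (w : cube d l) : {ffun 'I_d -> 'I_(2 * m).-1.+1} :=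
  [ffun i => inord (absz (cube_pos a w i - u i + m%:Z))].
have -> : ((2 * m) ^ d = #|{ffun 'I_d -> 'I_(2 * m).-1.+1}|)%N.
  by rewrite card_ffun !card_ord prednK // muln_gt0.
rewrite -(card_in_imset (f := f)); first exact: max_card.
move=> w w'; rewrite !inE => hw hw' e; apply/ffunP => i; apply: val_inj => /=.
have near (z : cube d l) : (l1dist u (cube_pos a z) < m)%N ->
    (absz (u i - cube_pos a z i) < m)%N.
  by rewrite /l1dist (bigD1 i) //=; lia.
have {}hw := near _ hw; have {}hw' := near _ hw'.
have := congr1 (fun g : {ffun 'I_d -> 'I_(2 * m).-1.+1} => val (g i)) e.
rewrite !ffunE /= in hw hw' *.
by rewrite !inordK; lia.
Qed.

(** [B] must be nonempty: on the empty set [dist_set] takes the default value 0. *)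
Lemma dist_set_ge d (T : finType) (pos : T -> site d) u (B : {set T}) m :
  (0 < #|B|)%N -> (forall v, v \in B -> (m <= l1dist u (pos v))%N) ->
  (m <= dist_set pos u B)%N.
Proof.
move=> /card_gt0P[v0 v0B] H; rewrite /dist_set; case: pickP => [v vB|/(_ v0)]; last by rewrite v0B.
by elim/big_rec: _ => [|w k wB mk]; rewrite ?leq_min ?H.
Qed.

(** * From contraction of Lipschitz constants to a Poincare inequality *)

Section WeightedGap.
Context (R : archiRealFieldType) (T S : finType) (mu : {ffun T -> S} -> R).
Context (mu_ge0 : forall s, 0 <= mu s) (mu_sum : \sum_s mu s = 1).
Context (J : finType) (w : J -> R) (w_ge0 : forall j, 0 <= w j) (W_ge1 : 1 <= \sum_j w j).
Context (P : J -> {ffun {ffun T -> S} -> R^o} -> {ffun {ffun T -> S} -> R^o}).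
Context (projP : forall j, projection mu (P j)).
Context (P1 : forall j, P j (finfun (fun=> 1)) = finfun (fun=> 1)).
Context (contract : forall (f : {ffun {ffun T -> S} -> R^o}) Dl, lipschitz f Dl ->
  forall v (sigma sigma' : {ffun T -> S}), (forall t, t != v -> sigma t = sigma' t) ->
  \sum_j w j * `|P j f sigma - P j f sigma'| <= Dl * (\sum_j w j - 2^-1)).

Lemma lipschitz_exists (f : {ffun T -> S} -> R) : exists Dl, lipschitz f Dl.
Proof.
exists (2 * \sum_s `|f s|) => v s t _.
have h x : `|f x| <= \sum_s `|f s|.
  by rewrite (bigD1 x) //= lerDl sumr_ge0.
by rewrite (le_trans (ler_normB _ _)) // mulr_natl mulr2n lerD.
Qed.

(** By [contract], the averaged update [A] multiplies Lipschitz constants by rho = 1 - 1/(2W), W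
    being the total weight. A centred function is bounded by [#|T|] times its Lipschitz constant, so
    the norm of [A^n f] decays like rho^n; [decay_one_step] discards the volume factor. The weight W
    cancels, leaving the constant 2. *)
Lemma weighted_gap (f : {ffun {ffun T -> S} -> R^o}) :
  dot mu f (finfun (fun=> 1)) = 0 ->
  sqnorm mu f <= 2 * \sum_j w j * sqnorm mu (f - P j f).
Proof.
move=> f0; have W1 := W_ge1; set W := \sum_j w j in W1.
have W0 : 0 < W by apply: lt_le_trans W1.
pose A (g : {ffun {ffun T -> S} -> R^o}) : {ffun {ffun T -> S} -> R^o} :=
  \sum_j (W^-1 * w j) *: P j g.
have Adot g k : dot mu g (A k) = \sum_j (W^-1 * w j) * dot mu g (P j k).
  by rewrite dot_sumr; apply: eq_bigr => j _; rewrite dotZr.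
have Asa g k : dot mu (A g) k = dot mu g (A k).
  rewrite dotC !Adot; apply: eq_bigr => j _; congr (_ * _).
  by have [_ _ sa] := projP j; rewrite dotC sa.
have A1 g : dot mu (A g) (finfun (fun=> 1)) = dot mu g (finfun (fun=> 1)).
  rewrite Asa Adot; under eq_bigr => j _ do rewrite P1.
  by rewrite -mulr_suml -mulr_sumr mulVf ?gt_eqF // mul1r.
(* Positive because W >= 1, as [decay_one_step] requires. *)
pose rho := 1 - (2 * W)^-1.
have rho0 : 0 < rho.
  rewrite subr_gt0 invf_lt1 ?mulr_gt0 //; lra.
have lipA (g : {ffun {ffun T -> S} -> R^o}) Dl : lipschitz g Dl -> lipschitz (A g) (rho * Dl).
  move=> lg v s t st.
  have -> : A g s - A g t = W^-1 * \sum_j w j * (P j g s - P j g t).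
    rewrite /A !sum_ffunE -sumrB mulr_sumr; apply: eq_bigr => j _.
    by rewrite !ffunE mulrA mulrBr.
  rewrite normrM ger0_norm ?invr_ge0 ?(ltW W0) // mulrC ler_pdivrMr //.
  apply: le_trans (ler_norm_sum _ _ _) _.
  under eq_bigr => j _ do rewrite normrM ger0_norm //.
  apply: le_trans (contract lg st) _; rewrite -/W le_eqVlt; apply/orP; left; apply/eqP.
  by rewrite /rho; field; rewrite gt_eqF.
have [Dl lf] := lipschitz_exists f.
have lipn n : lipschitz (iter n A f) (rho ^+ n * Dl).
  by elim: n => [|n IH]; [rewrite mul1r|rewrite iterS exprS -mulrA; apply: lipA].
have mean n : dot mu (iter n A f) (finfun (fun=> 1)) = 0.
  by elim: n => // n IH; rewrite iterS A1.
have decay n : sqnorm mu (iter n A f) <= (#|T|%:R * Dl) ^+ 2 * (rho ^+ 2) ^+ n.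
  set g := iter n A f.
  have bd s : (g s : R) ^+ 2 <= (#|T|%:R * Dl) ^+ 2 * (rho ^+ 2) ^+ n.
    have -> : (#|T|%:R * Dl) ^+ 2 * (rho ^+ 2) ^+ n = (#|T|%:R * (rho ^+ n * Dl)) ^+ 2.
      by rewrite -exprM mulnC exprM; ring.
    have -> : (g s : R) = \sum_t mu t * (g s - g t).
      under eq_bigr => t _ do rewrite mulrBr.
      rewrite sumrB -mulr_suml mu_sum mul1r.
      have -> : \sum_t mu t * g t = 0; last by rewrite subr0.
      by rewrite -[RHS](mean n); apply: eq_bigr => t _; rewrite ffunE mulr1.
    rewrite -[X in X <= _]real_normK ?num_real // ler_pXn2r ?nnegrE //; last first.
      have := lipschitz_osc s s (lipn n); rewrite subrr normr0 => h0; exact: h0.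
    apply: le_trans (ler_norm_sum _ _ _) _.
    set C := #|T|%:R * _; have -> : C = \sum_t mu t * C by rewrite -mulr_suml mu_sum mul1r.
    apply: ler_sum => t _.
    rewrite normrM ger0_norm // ler_wpM2l //; exact: lipschitz_osc (lipn n).
  set C := _ * _ in bd *; have -> : C = \sum_s mu s * C by rewrite -mulr_suml mu_sum mul1r.
  by apply: ler_sum => s _; rewrite ler_wpM2l // -expr2.
have := decay_one_step mu_ge0 Asa rho0 decay.
rewrite Adot.
have -> : \sum_j (W^-1 * w j) * dot mu f (P j f) =
  sqnorm mu f - W^-1 * \sum_j w j * sqnorm mu (f - P j f).
  have -> : sqnorm mu f = \sum_j (W^-1 * w j) * sqnorm mu f.
    by rewrite -mulr_suml -mulr_sumr mulVf ?gt_eqF // mul1r.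
  rewrite mulr_sumr -sumrB; apply: eq_bigr => j _.
  by rewrite (projection_pythagoras (projP j)) (projection_dot (projP j)); ring.
rewrite /rho invfM => h.
set X := \sum_j _ in h *; have : (2^-1 * W^-1) * sqnorm mu f <= W^-1 * X by lra.
by rewrite -mulrA mulrCA ler_pM2l ?invr_gt0 // mulrC ler_pdivrMr // mulrC.
Qed.

End WeightedGap.

(** * The Poincare inequality for single-site updates on cubes *)

Section GlauberGap.
Context (R : archiRealFieldType) (d : nat) (S : finType) (Ue : S -> S -> R) (Wv : S -> R).
Context (Ue_ge0 : forall s t, 0 <= Ue s t) (Ue_sym : forall s t, Ue s t = Ue t s).
Context (Wv_gt0 : forall s, 0 < Wv s) (perm : permissive d Ue Wv).
Context (irred : glauber_irreducible d Ue Wv) (ssm : SSM d Ue Wv).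

Definition site_spec (T : finType) (pos : T -> site d) psi (v : T) :=
  spec Ue Wv (fun _ : unit => pos v) pos psi (fun _ => v).

Lemma unit_map_inj (T : Type) (v : T) : injective (fun _ : unit => v).
Proof. by move=> [] []. Qed.

Lemma codom_unit (T : finType) (v t : T) : (t \in codom (fun _ : unit => v)) = (t == v).
Proof. by apply/codomP/eqP => [[_ ->]|->] //; exists tt. Qed.

Lemma site_spec_local (T : finType) (pos : T -> site d) psi (v : T) f
    (sigma sigma' : {ffun T -> S}) :
  injective pos -> (forall t, t != v -> sigma t = sigma' t) ->
  site_spec pos psi v f sigma = site_spec pos psi v f sigma'.
Proof.
move=> pinj e.
by apply: (spec_lipschitz_in Ue Wv (unit_map_inj (v := v)) pinj _ psi f e); rewrite ?codom_unit.
Qed.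

Section Subregion.
Context (T' T : finType) (pos' : T' -> site d) (pos : T -> site d) (h : T' -> T).
Context (hinj : injective h) (pinj : injective pos) (hpos : forall t, pos (h t) = pos' t).
Context (psi : site d -> option S).
Local Notation mu := (gibbs Ue Wv pos psi).

(** After disintegration, each outer configuration contributes a variance in the subregion, to which
    the local gap applies with [k] the site updates of the large region. *)
Lemma spec_local_gap K f : has_local_gap d Ue Wv T' K ->
  sqnorm mu (f - spec Ue Wv pos' pos psi h f) <=
  K * \sum_t sqnorm mu (f - site_spec pos psi (h t) f).
Proof.
move=> lg; have [c c0 cE] :=
  gibbs_disintegration Ue_ge0 Ue_sym Wv_gt0 perm hinj pinj hpos psi.
have sqE g : sqnorm mu (f - g) = \sum_s c s *
    \sum_tau gibbs Ue Wv pos' (bc pos psi s) tau * ((f (glue h tau s) : R) - g (glue h tau s)) ^+ 2.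
  rewrite -(cE (fun s => ((f s : R) - g s) ^+ 2)); apply: eq_bigr => s _.
  by rewrite !ffunE expr2.
rewrite sqE; under [X in _ <= _ * X]eq_bigr => t _ do rewrite sqE.
rewrite exchange_big mulr_sumr; apply: ler_sum => s _.
rewrite -mulr_sumr mulrCA ler_wpM2l //.
under eq_bigr => tau _ do rewrite (spec_glue Ue Wv hinj pinj hpos) ffunE.
apply: (lg pos' _ (pos'_inj hinj pinj hpos) (fun tau => f (glue h tau s))
  (fun t tau => site_spec pos psi (h t) f (glue h tau s))).
move=> v tau tau' e; apply: site_spec_local => // t tv.
have [/codomP[t' tE]|th] := boolP (t \in codom h); last by rewrite !glue_out.
by rewrite tE !glue_in // e //; apply: contraNneq tv => <-; rewrite tE.
Qed.

End Subregion.

Lemma has_local_gap_le (T : finType) K K' : K <= K' ->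
  has_local_gap d Ue Wv T K -> has_local_gap d Ue Wv T K'.
Proof.
move=> KK lg pos psi pinj g k kinv /=; apply: le_trans (lg pos psi pinj g k kinv) _.
rewrite ler_wpM2r //; do 2 (apply: sumr_ge0 => ? _).
by rewrite mulr_ge0 ?gibbs_ge0 // sqr_ge0.
Qed.

(** Handles the finitely many sides too small for the subcube argument. *)
Lemma local_gap_upto N : exists2 K : R, 0 <= K &
  forall n, (n < N)%N -> has_local_gap d Ue Wv (cube d n) K.
Proof.
elim: N => [|N [K K0 IH]]; first by exists 0.
have [K' K'0 lg] := local_gap Ue_ge0 Wv_gt0 perm irred (cube d N).
exists (K + K') => [|n]; first exact: addr_ge0.
rewrite ltnS leq_eqVlt => /orP[/eqP ->|/IH].
  by apply: has_local_gap_le lg; rewrite lerDr.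
by apply: has_local_gap_le; rewrite lerDl.
Qed.

Section LargeCube.
Context (b theta : R) (b0 : 0 < b) (theta01 : 0 < theta < 1).
Context (mixing : forall (a : site d) (L : nat), (0 < L)%N ->
    forall (B : {set cube d L}) (u : site d) (psi psi' : site d -> option S),
      boundary (cube_pos (L:=L) a) u ->
      (forall w, w != u -> psi w = psi' w) ->
      tv_marginal Ue Wv (cube_pos (L:=L) a) psi psi' B
        <= b * theta ^+ dist_set (cube_pos (L:=L) a) u B).
Context (m q l : nat) (m0 : (0 < m)%N) (q0 : (0 < q)%N) (lq : l = (q * q)%N).

(** Excess factor for a discrepancy on the boundary of a subcube: at most (2m)^d sites are closer
    than m and are bounded trivially; SSM controls the others, at most l^d in number. *)
Definition disagreement : R := 2 * ((2 * m) ^ d)%:R + 2 * (l ^ d)%:R * (b * theta ^+ m).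
Context (small : 4 * d%:R * disagreement <= q%:R).

Lemma disagreement_ge0 : 0 <= disagreement.
Proof.
have /andP[t0 _] := theta01.
by rewrite addr_ge0 ?mulr_ge0 ?exprn_ge0 // ltW.
Qed.

Section Fixed.
Context (L : nat) (lL : (2 * l <= L)%N) (a : site d) (psi : site d -> option S).
Let lL' : (l <= L)%N. Proof. lia. Qed.
Local Notation pos := (cube_pos (L := L) a).
Local Notation P x := (spec Ue Wv (cube_pos (L := l) (subcube_origin a x)) pos psi (subcube_map lL' x)).

Let l0 : (0 < l)%N. Proof. by rewrite lq muln_gt0 q0. Qed.

Lemma subcube_spec_lipschitz x (f : {ffun {ffun cube d L -> S} -> R^o}) Dl
    (v : cube d L) (sigma sigma' : {ffun cube d L -> S}) :
  lipschitz f Dl -> (forall t, t != v -> sigma t = sigma' t) ->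
  `|P x f sigma - P x f sigma'| <=
    Dl * (1 - (in_subcube x v)%:R + disagreement * (near_subcube x v)%:R).
Proof.
move=> lf e; have Dl0 : 0 <= Dl.
  by apply: le_trans (lf v sigma sigma' e).
have D0 := disagreement_ge0.
have hinj : injective (subcube_map lL' x) := @subcube_map_inj d l L lL' x.
have pinj : injective pos := @cube_pos_inj d L a.
have hpos := subcube_mapE lL' a x.
have [vin|vin] := boolP (in_subcube x v).
  rewrite subrr add0r.
  have -> : P x f sigma = P x f sigma'.
    by apply: (spec_lipschitz_in Ue Wv hinj pinj hpos psi f e); rewrite -in_subcubeE.
  by rewrite subrr normr0 !mulr_ge0.
rewrite subr0.
have [bv|bv] := boolP (boundary (cube_pos (L := l) (subcube_origin a x)) (pos v)); last first.
  apply: le_trans (spec_lipschitz_far Ue_ge0 Wv_gt0 perm hinj pinj hpos psi lf e bv) _.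
  by rewrite ler_peMr // lerDl mulr_ge0.
rewrite (boundary_near_subcube lL' bv) mulr1.
pose B := [set w : cube d l | (m <= l1dist (pos v) (cube_pos (subcube_origin a x) w))%N].
have tv : tv_marginal Ue Wv (cube_pos (subcube_origin a x)) (bc pos psi sigma)
    (bc pos psi sigma') B <= b * theta ^+ dist_set (cube_pos (subcube_origin a x)) (pos v) B.
  apply: mixing => // w wv; apply: bc_local => t tw; apply: e.
  by apply: contraNneq wv => <-; rewrite tw.
apply: le_trans (spec_lipschitz_boundary Ue_ge0 Wv_gt0 perm hinj pinj hpos lf e tv) _.
rewrite ler_wpM2l // -addrA lerD2l /disagreement lerD //.
  rewrite ler_wpM2l // ler_nat.
  have -> : ~: B = [set w : cube d l | (l1dist (pos v) (cube_pos (subcube_origin a x) w) < m)%N].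
    by apply/setP => w; rewrite !inE ltnNge.
  exact: card_near_site.
have [B0|B0] := posnP #|B|.
  rewrite B0 mulr0 mul0r; have /andP[t0 _] := theta01.
  by rewrite !mulr_ge0 ?exprn_ge0 // ltW.
have /andP[t0 t1] := theta01.
apply: ler_pM; first by rewrite mulr_ge0.
- by rewrite mulr_ge0 ?exprn_ge0 // ltW.
- rewrite ler_wpM2l // ler_nat; apply: leq_trans (max_card _) _.
  by rewrite card_ffun !card_ord.
apply: ler_wpM2l; first exact: ltW.
apply: ler_wiXn2l; rewrite ?ltW //.
by apply: dist_set_ge => // w; rewrite inE.
Qed.

(** [weighted_gap] applies to the weighted subcube updates; each is then compared with its own
    sites, and a site is charged its total coverage, at most (l q)^d. *)
Lemma large_cube_gap K (f : {ffun {ffun cube d L -> S} -> R^o}) : 0 <= K ->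
  has_local_gap d Ue Wv (cube d l) K ->
  dot (gibbs Ue Wv pos psi) f (finfun (fun=> 1)) = 0 ->
  sqnorm (gibbs Ue Wv pos psi) f <= 2 * K * ((l * q) ^ d)%:R *
    \sum_v sqnorm (gibbs Ue Wv pos psi) (f - site_spec pos psi v f).
Proof.
move=> K0 lg f0; have pinj : injective pos := @cube_pos_inj d L a.
have mu0 s : 0 <= gibbs Ue Wv pos psi s by apply: gibbs_ge0.
pose w (x : starts d l L) : R := (subcube_weight q x)%:R.
have cover_ge1 (v : cube d L) : (0 < \prod_i coverage q l L (v i))%N.
  rewrite prodn_gt0 // => i; apply: leq_trans q0 _.
  by apply: coverage_ge => //; apply: ltn_ord.
have hinj x : injective (subcube_map lL' x) := @subcube_map_inj d l L lL' x.
have hpos x := subcube_mapE lL' a x.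
have w_ge1 : 1 <= \sum_x w x.
  rewrite -natr_sum ler1n (bigD1 [ffun=> ord0]) //= addn_gt0; apply/orP; left.
  by rewrite prodn_gt0 // => i; apply: window_weight_gt0.
apply: le_trans (weighted_gap (w := w) (P := fun x => P x) _ _ _ _ _ _ _ f0) _ => //.
- exact: sum_gibbs.
- by move=> x; apply: spec_projection.
- by move=> x; apply: spec_const.
- move=> g Dl lg' v sigma sigma' e.
  have Dl0 : 0 <= Dl by apply: le_trans (lg' v sigma sigma' e).
  apply: (@le_trans _ _ (\sum_x w x *
    (Dl * (1 - (in_subcube x v)%:R + disagreement * (near_subcube x v)%:R)))).
    by apply: ler_sum => x _; rewrite ler_wpM2l ?subcube_spec_lipschitz // /w.
  set c : R := (\prod_i coverage q l L (v i))%:R.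
  have c1 : 1 <= c by rewrite ler1n.
  set nr : R := (\sum_(x : starts d l L | near_subcube x v) subcube_weight q x)%:R.
  have -> : \sum_x w x * (Dl * (1 - (in_subcube x v)%:R + disagreement * (near_subcube x v)%:R)) =
      Dl * (\sum_x w x - c + disagreement * nr).
    rewrite /c -sum_in_subcube /nr !natr_sum [X in _ - X]big_mkcond [X in disagreement * X]big_mkcond /=.
    rewrite mulr_sumr -sumrN -!big_split mulr_sumr /=; apply: eq_bigr => x _.
    by rewrite /w; case: in_subcube; case: near_subcube => /=; ring.
  rewrite ler_wpM2l // -addrA lerD2l.
  (* With [small] this gives disagreement * nr <= c / 2; the net gain c / 2 is at least 1/2 because
     c >= 1. *)
  have : q%:R * nr <= 2 * d%:R * c.
    by rewrite /nr /c -!natrM ler_nat; apply: sum_near_subcube.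
  have nr0 : 0 <= nr by [].
  have := ler_wpM2r nr0 small => h1 h2.
  have h3 : d%:R * (4 * (disagreement * nr)) <= d%:R * (2 * c).
    by apply: le_trans (le_trans _ h1) (le_trans h2 _); rewrite le_eqVlt; apply/orP; left; apply/eqP; ring.
  have [d0|d0] := posnP d.
    have : nr = 0.
      rewrite /nr big_pred0 // => x; apply/negbTE/existsPn => i.
      by exfalso; have := ltn_ord i; lia.
    by move=> ->; rewrite mulr0 addr0; lra.
  by move: h3; rewrite ler_pM2l ?ltr0n //; lra.
rewrite -!mulrA ler_wpM2l //.
apply: (@le_trans _ _ (\sum_x w x * (K * \sum_y
    sqnorm (gibbs Ue Wv pos psi) (f - site_spec pos psi (subcube_map lL' x y) f)))).
  by apply: ler_sum => x _; rewrite ler_wpM2l ?spec_local_gap // /w.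
under eq_bigr => x _ do rewrite mulrCA.
rewrite -mulr_sumr ler_wpM2l //.
rewrite (eq_bigr (fun x => \sum_v (if in_subcube x v then
    w x * sqnorm (gibbs Ue Wv pos psi) (f - site_spec pos psi v f) else 0))); last first.
  move=> x _; rewrite -big_mkcond /= mulr_sumr.
  rewrite (eq_bigl (fun v => (v \in codom (subcube_map lL' x)) && predT v)); last first.
    by move=> v; rewrite (in_subcubeE lL') andbT.
  by rewrite big_codom.
rewrite exchange_big mulr_sumr; apply: ler_sum => v _.
rewrite -big_mkcond -mulr_suml ler_wpM2r ?sqnorm_ge0 //.
rewrite -natr_sum ler_nat sum_in_subcube.
have -> : ((l * q) ^ d = \prod_(i < d) (l * q))%N by rewrite prod_nat_const card_ord.
by apply: leq_prod => i _; apply: coverage_le.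
Qed.

End Fixed.
End LargeCube.

(** The scales m, q, l are fixed by the SSM constants and [d] only. Cubes of side at least 2l use
    subcubes of side l; smaller ones use [local_gap_upto]. *)
Lemma glauber_gap : (0 < d)%N -> exists2 K : R, 0 <= K &
  forall (a : site d) (L : nat) (psi : site d -> option S) (f : {ffun {ffun cube d L -> S} -> R^o}),
    let mu := gibbs Ue Wv (cube_pos (L := L) a) psi in
    dot mu f (finfun (fun=> 1)) = 0 ->
    sqnorm mu f <= K * \sum_v sqnorm mu (f - site_spec (cube_pos (L := L) a) psi v f).
Proof.
move=> d0; have [b b0 [theta theta01 mixing]] := ssm.
(* Chosen so that, for q and l below, C m^(d 2d) theta^m is exactly 16 d l^d b theta^m. *)
pose C : R := (16 * d%:R * b) * ((16 * d * 2 ^ d) ^ (2 * d))%:R.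
have C0 : 0 <= C by rewrite !mulr_ge0 // ltW.
have [m m0 mP] := poly_exp_small (d * (2 * d)) C0 theta01.
(* The near part of [4 * d * disagreement] is then exactly q/2, and the SSM part is at most 1/2 by
   the choice of m. *)
pose q := (16 * d * (2 * m) ^ d)%N; pose l := (q * q)%N.
have q0 : (0 < q)%N by rewrite !muln_gt0 d0 expn_gt0 muln_gt0 m0.
have small : 4 * d%:R * disagreement b theta m l <= q%:R.
  have e1 : C * m%:R ^+ (d * (2 * d)) * theta ^+ m =
      16 * d%:R * (l ^ d)%:R * (b * theta ^+ m).
    have -> : (l ^ d = (16 * d * 2 ^ d) ^ (2 * d) * m ^ (d * (2 * d)))%N.
      by rewrite /l mulnn -expnM /q [((2 * m) ^ d)%N]expnMn mulnA expnMn -expnM.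
    rewrite natrM [(m ^ _)%:R]natrX /C; move: (_ ^ (2 * d))%:R (m%:R ^+ _) (theta ^+ m) => x y z.
    ring.
  have q1 : (1 : R) <= q%:R by rewrite ler1n.
  move: mP; rewrite e1 => mP.
  have -> : 4 * d%:R * disagreement b theta m l = 2^-1 * q%:R +
      2^-1 * (16 * d%:R * (l ^ d)%:R * (b * theta ^+ m)).
    by rewrite /disagreement /q !natrM; field.
  lra.
have [K1 K10 lg1] := local_gap_upto (2 * l).
have [K2 K20 lg2] := local_gap Ue_ge0 Wv_gt0 perm irred (cube d l).
have K3 : 0 <= 2 * K2 * ((l * q) ^ d)%:R by rewrite !mulr_ge0.
exists (K1 + 2 * K2 * ((l * q) ^ d)%:R) => [|a L psi f mu f0]; first exact: addr_ge0.
have mu0 s : 0 <= mu s by apply: gibbs_ge0.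
have pinj : injective (cube_pos (L := L) a) := @cube_pos_inj d L a.
set Sg := \sum_v _; have Sg0 : 0 <= Sg by apply: sumr_ge0 => v _; apply: sqnorm_ge0.
have [Ll|Ll] := ltnP L (2 * l).
  have m0f : \sum_s mu s * f s = 0.
    by rewrite -[RHS]f0; apply: eq_bigr => s _; rewrite ffunE mulr1.
  apply: (@le_trans _ _ (K1 * Sg)); last by rewrite ler_wpM2r // lerDl.
  have lk v (s s' : {ffun cube d L -> S}) : (forall t, t != v -> s t = s' t) ->
      site_spec (cube_pos (L := L) a) psi v f s = site_spec (cube_pos (L := L) a) psi v f s'.
    exact: site_spec_local.
  have E g : sqnorm mu (f - g) = \sum_s mu s * ((f s : R) - g s) ^+ 2.
    by apply: eq_bigr => s _; rewrite !ffunE expr2.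
  have -> : sqnorm mu f = \sum_s mu s * ((f s : R) - 0) ^+ 2.
    by apply: eq_bigr => s _; rewrite subr0 expr2.
  have := lg1 L Ll _ psi pinj f _ lk; rewrite /= -/mu m0f => h.
  apply: le_trans h _; rewrite ler_wpM2l //.
  by apply: ler_sum => v _; rewrite E.
apply: (@le_trans _ _ (2 * K2 * ((l * q) ^ d)%:R * Sg)); last by rewrite ler_wpM2r // lerDr.
exact: (large_cube_gap b0 theta01 mixing m0 q0 erefl small).
Qed.

End GlauberGap.

(** * Commuting projections: tensorization and covers *)

Section Tensorization.
Context (R : realFieldType) (X : finType) (mu : X -> R) (mu_ge0 : forall x, 0 <= mu x).
Context (T : finType) (P : T -> {ffun X -> R^o} -> {ffun X -> R^o}).
Context (projP : forall v, projection mu (P v)).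

(** Adding [P u] in front of the scan Q of [s] loses, by Pythagoras, |Q f - P u Q f|^2 = |Q (f - P u
    f)|^2, which is at most |f - P u f|^2. *)
Lemma scan_tensorization (s : seq T) f :
  (forall u w, u \in s -> w \in s -> forall g, P u (P w g) = P w (P u g)) ->
  sqnorm mu (f - scan P s f) <= \sum_(v <- s) sqnorm mu (f - P v f).
Proof.
elim: s => [|u s IH] H; first by rewrite big_nil /= subrr sqnorm0.
have Hs : forall u w, u \in s -> w \in s -> forall g, P u (P w g) = P w (P u g).
  by move=> a b sa sb; apply: H; rewrite in_cons ?sa ?sb orbT.
have pus := scan_projection projP H; have ps := scan_projection projP Hs.
rewrite big_cons (projection_pythagoras pus) /=.
have := IH Hs; rewrite (projection_pythagoras ps) => {}IH.
have := projection_pythagoras (projP u) (scan P s f).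
have -> : scan P s f - P u (scan P s f) = scan P s (f - P u f).
  rewrite (projection_sub ps) scan_commute // => w ws.
  by apply: H; rewrite in_cons ?eqxx ?ws ?orbT.
have := projection_contract mu_ge0 ps (f - P u f); lra.
Qed.

End Tensorization.

Section Cover.
Context (R : realFieldType) (X : finType) (mu : X -> R) (mu_ge0 : forall x, 0 <= mu x).
Context (T : finType) (P : T -> {ffun X -> R^o} -> {ffun X -> R^o}).
Context (projP : forall v, projection mu (P v)).

Lemma scan_scan_commute (s s' : seq T) f :
  (forall u w, u \in s -> w \in s' -> forall g, P u (P w g) = P w (P u g)) ->
  scan P s (scan P s' f) = scan P s' (scan P s f).
Proof.
elim: s => //= u s IH H; rewrite IH.
  by rewrite scan_commute // => w ws; apply: H; rewrite ?in_cons ?eqxx.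
by move=> a b sa sb; apply: H; rewrite // in_cons sa orbT.
Qed.

(** Let g be the product of all the block scans applied to [f]. As the blocks cover [s], every [P v]
    fixes g, so f - scan f = (1 - scan)(f - g), and |f - g|^2 tensorizes over the commuting block
    scans. *)
Lemma scan_cover (s : seq T) (r : nat) (A : 'I_r -> {set T}) f :
  (forall u w, u \in s -> w \in s -> forall g, P u (P w g) = P w (P u g)) ->
  (forall v, v \in s -> exists i, v \in A i) ->
  sqnorm mu (f - scan P s f) <=
    \sum_i sqnorm mu (f - scan P [seq v <- s | v \in A i] f).
Proof.
move=> com cov; pose Q i := scan P [seq v <- s | v \in A i].
have comi i u w : u \in [seq v <- s | v \in A i] -> w \in s ->
    forall g, P u (P w g) = P w (P u g).
  by rewrite mem_filter => /andP[_ us] ws g; apply: com.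
have sub i u : u \in [seq v <- s | v \in A i] -> u \in s by rewrite mem_filter => /andP[].
have pQ i : projection mu (Q i).
  by apply: scan_projection => // u w ui /sub; apply: comi ui.
have cQ i j g : Q i (Q j g) = Q j (Q i g).
  by apply: scan_scan_commute => u w ui /sub; apply: comi ui.
have ps := scan_projection projP com.
set g := scan Q (enum 'I_r) f.
have gfix v : v \in s -> P v g = g.
  move=> vs; have [i vi] := cov v vs.
  have gi : Q i g = g.
    by apply: (scan_fixed pQ); rewrite ?mem_enum // => j k _ _ k'; apply: cQ.
  rewrite -{1}gi (scan_fixed projP) //; last by rewrite mem_filter vi.
  by move=> u w ui /sub; apply: comi ui.
have -> : f - scan P s f = (f - g) - scan P s (f - g).
  rewrite (projection_sub ps) [scan P s g]scan_fix //.
  by apply/ffunP => x; rewrite !ffunE; ring.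
apply: le_trans (projection_cocontract mu_ge0 ps _) _.
have := scan_tensorization mu_ge0 pQ (s := enum 'I_r) f; rewrite big_enum /=.
by apply=> i j _ _ k; apply: cQ.
Qed.

End Cover.

(** * The Poincare inequality for arbitrary covers by blocks *)

Section BlockGap.
Context (R : archiRealFieldType) (d : nat) (S : finType) (Ue : S -> S -> R) (Wv : S -> R).
Context (Ue_ge0 : forall s t, 0 <= Ue s t) (Ue_sym : forall s t, Ue s t = Ue t s).
Context (Wv_gt0 : forall s, 0 < Wv s) (perm : permissive d Ue Wv).
Context (irred : glauber_irreducible d Ue Wv) (ssm : SSM d Ue Wv).

Definition agree_off (T : finType) (A : {set T}) (sigma tau : {ffun T -> S}) : bool :=
  [forall x in ~: A, sigma x == tau x].

(** Conditional expectation in the shape used by [block_kernel]; it is 0 on fibres of mass zero, by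
    the convention for division by 0. *)
Definition cond_exp (T : finType) (mu : {ffun T -> S} -> R) (A : {set T})
    (f : {ffun {ffun T -> S} -> R^o}) : {ffun {ffun T -> S} -> R^o} :=
  [ffun sigma => (\sum_(tau | agree_off A sigma tau) mu tau * f tau) /
     \sum_(tau | agree_off A sigma tau) mu tau].

Lemma agree_offP (T : finType) (A : {set T}) (sigma tau : {ffun T -> S}) :
  reflect (forall x, x \notin A -> sigma x = tau x) (agree_off A sigma tau).
Proof.
apply: (iffP forall_inP) => [H x xA|H x]; first by apply/eqP/H; rewrite inE.
by rewrite inE => /H ->.
Qed.

Lemma eq_agree_off (T : finType) (A : {set T}) (sigma sigma' : {ffun T -> S}) :
  agree_off A sigma sigma' -> agree_off A sigma =1 agree_off A sigma'.
Proof.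
move=> /agree_offP e tau; apply/agree_offP/agree_offP => H x xA.
  by rewrite -e ?H.
by rewrite e ?H.
Qed.

Lemma cond_exp_local (T : finType) (mu : {ffun T -> S} -> R) (A : {set T}) f
    (sigma sigma' : {ffun T -> S}) :
  agree_off A sigma sigma' -> cond_exp mu A f sigma = cond_exp mu A f sigma'.
Proof.
move=> e; rewrite !ffunE; congr (_ / _); apply: eq_bigl; exact: eq_agree_off.
Qed.

Definition even_sites L : {set cube d L} := [set v : cube d L | ~~ odd (\sum_i (v i : nat))].

Lemma adjacent_parity L (a : site d) (u v : cube d L) :
  adjacent (cube_pos a u) (cube_pos a v) -> (u \in even_sites L) = (v \notin even_sites L).
Proof.
move=> /adjacentP[i [b e]]; rewrite !inE negbK.
have ej j : (v j : nat)%:Z = (u j : nat)%:Z + (if j == i then if b then 1 else -1 else 0).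
  have := congr1 (fun f : site d => f j) e; rewrite !ffunE.
  move: (a j) (v j : nat)%:Z (u j : nat)%:Z => A B C {e}.
  by case: eqP => _; case: (b); lia.
rewrite (bigD1 i) //= [in RHS](bigD1 i) //=.
have -> : (\sum_(j < d | j != i) v j = \sum_(j < d | j != i) u j)%N.
  by apply: eq_bigr => j ji; have := ej j; rewrite (negPf ji); lia.
have := ej i; rewrite eqxx !oddD.
have : (v i : nat)%:Z = (u i : nat)%:Z + 1 \/ (v i : nat)%:Z = (u i : nat)%:Z - 1 ->
   odd (v i) = ~~ odd (u i) by lia.
by move=> H h; rewrite H ?addNb ?negb_add; [case: odd; case: odd|case: b h {e ej}; lia].
Qed.

(** Neighbours are told apart by their direction; the extra unit counts the value [None] of
    [pick]. *)
Lemma card_adjacent L (a : site d) (v : cube d L) :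
  (#|[set u : cube d L | adjacent (cube_pos a v) (cube_pos a u)]| <= (2 * d).+1)%N.
Proof.
pose f (u : cube d L) := [pick p : 'I_d * bool | cube_pos a u == nbr (cube_pos a v) p.1 p.2].
have -> : ((2 * d).+1 = #|{: option ('I_d * bool)}|)%N.
  by rewrite card_option card_prod card_ord card_bool mulnC.
rewrite -(card_in_imset (f := f)); first exact: max_card.
move=> u w; rewrite !inE => /adjacentP[i [b eu]] /adjacentP[j [c ew]]; rewrite /f.
case: pickP => [p /eqP pu|/(_ (i, b))]; last by rewrite eu eqxx.
case: pickP => // p' /eqP pw [pp]; apply: (@cube_pos_inj d L a).
by rewrite pu pw pp.
Qed.

(** [layered_gap] with the parity classes reduces to one layer at a time; each layer is bounded by
    the full sum over blocks, whence the factor 2. *)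
Lemma block_gap : (0 < d)%N -> exists2 C : R, 0 < C &
  forall (a : site d) (L : nat) (psi : site d -> option S) (r : nat) (A : 'I_r -> {set cube d L})
    (f : {ffun {ffun cube d L -> S} -> R^o}),
    let mu := gibbs Ue Wv (cube_pos (L := L) a) psi in
    \bigcup_(i < r) A i = [set: cube d L] ->
    dot mu f (finfun (fun=> 1)) = 0 ->
    sqnorm mu f <= C * \sum_i sqnorm mu (f - cond_exp mu (A i) f).
Proof.
move=> d0; have [K K0 gap] := glauber_gap Ue_ge0 Ue_sym Wv_gt0 perm irred ssm d0.
pose D : R := (2 * d).+1%:R ^+ 2.
have KD : 0 <= K * D by rewrite mulr_ge0 ?exprn_ge0.
pose C := 2 * (1 + K * D) + 1 + 2 * K * D.
have C0 : 0 < C by rewrite /C -(mulrA 2 K); lra.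
exists (C * 2) => [|a L psi r A f mu cov f0]; first by rewrite mulr_gt0.
pose pos := cube_pos (L := L) a; pose P := site_spec Ue Wv pos psi.
have pinj : injective pos := @cube_pos_inj d L a.
have mu0 s : 0 <= mu s by apply: gibbs_ge0.
have projP v : projection mu (P v).
  by apply: spec_projection => //; apply: unit_map_inj.
have com u v : ~~ adjacent (pos u) (pos v) -> forall g, P v (P u g) = P u (P v g).
  move=> nuv g; have [->//|uv] := eqVneq u v.
  apply: spec_commute => //; try exact: unit_map_inj.
    by move=> _ _; rewrite eq_sym.
  by move=> _ _; rewrite adjacentC.
have comE (E : bool) u w : (u \in even_sites L) = E -> (w \in even_sites L) = E ->
    forall g, P u (P w g) = P w (P u g).
  move=> uE wE; apply: com; apply/negP => /adjacent_parity; rewrite uE wE.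
  by case: (E).
have layer (E : bool) (s : seq (cube d L)) : (forall v, v \in s -> (v \in even_sites L) = E) ->
    sqnorm mu (f - scan P s f) <= \sum_i sqnorm mu (f - cond_exp mu (A i) f).
  move=> sE; have coms u w : u \in s -> w \in s -> forall g, P u (P w g) = P w (P u g).
    by move=> us ws; apply: (comE E); apply: sE.
  apply: le_trans (scan_cover (A := A) mu0 projP f coms _) _.
    by move=> v _; have := in_setT v; rewrite -cov => /bigcupP[i _ vi]; exists i.
  apply: ler_sum => i _; set Q := scan P _; set g := cond_exp mu (A i) f.
  have pQ : projection mu Q.
    apply: scan_projection => // u w; rewrite !mem_filter => /andP[_ us] /andP[_ ws].
    exact: coms.
  (* [g] does not depend on the spins in [A i], and [Q] resamples only sites of [A i]; hence f - Q f
     = (1 - Q)(f - g). *)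
  have Qg : Q g = g.
    apply: scan_fix => v; rewrite mem_filter => /andP[vA _].
    apply: spec_fix => //; first exact: unit_map_inj.
    move=> tau sigma.
    apply: cond_exp_local; apply/agree_offP => x xA; rewrite glue_out //.
    by rewrite codom_unit; apply: contraNneq xA => ->.
  have -> : f - Q f = (f - g) - Q (f - g).
    rewrite (projection_sub pQ) Qg; apply/ffunP => x; rewrite !ffunE; ring.
  exact: projection_cocontract.
have := layered_gap mu0 projP (nb := fun u v => adjacent (pos u) (pos v)) (E := even_sites L)
  (Delta := (2 * d).+1) _ _ com _ (C := K) (f := f) K0 _ _.
rewrite -/D -/C => H; apply: le_trans (H _ _ _ _ _) _.
- move=> v; apply: leq_trans (card_adjacent a v); apply: eq_leq.
  by apply: eq_card => u; rewrite !inE adjacentC.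
- by move=> u; apply: card_adjacent.
- by move=> u v; apply: adjacent_parity.
- by move=> g g1; apply: gap; rewrite g1.
- by move=> v; apply: spec_const => //; apply: unit_map_inj.
rewrite -mulrA ler_pM2l // mulr_natl mulr2n lerD //.
  by apply: (layer true) => v; rewrite mem_enum.
by apply: (layer false) => v; rewrite mem_enum in_setC => /negPf.
Qed.

End BlockGap.

(** * Spectra of real symmetric matrices *)

Lemma char_poly_conj (F : fieldType) n (V A B : 'M[F]_n) :
  V \in unitmx -> A = invmx V *m B *m V -> char_poly A = char_poly B.
Proof.
move=> Vu ->; rewrite /char_poly /char_poly_mx !map_mxM.
set V1 := map_mx _ (invmx V); set V2 := map_mx _ V; set B1 := map_mx _ B.
have V12 : V1 *m V2 = 1%:M by rewrite -map_mxM mulVmx // map_mx1.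
have -> : 'X%:M - V1 *m B1 *m V2 = V1 *m ('X%:M - B1) *m V2.
  rewrite mulmxBr mulmxBl; congr (_ - _).
  by rewrite mul_mx_scalar -scalemxAl V12 scalemx1.
by rewrite !det_mulmx mulrAC -det_mulmx V12 det1 mul1r.
Qed.

Section SymmetricSpectrum.
Context (R : rcfType).
Local Open Scope complex_scope.

(** Unitary diagonalisation over the complex numbers, read in real terms: [a i] and [b i] are the
    real and imaginary parts of the i-th eigenvector, and the last two clauses are those of
    unitarity. *)
Lemma symmetric_spectrum n (N : 'M[R]_n) : N^T = N ->
  exists (r : 'I_n -> R) (a b : 'I_n -> 'I_n -> R),
  [/\ char_poly N = \prod_i ('X - (r i)%:P),
      forall i j, \sum_k a i k * N k j = r i * a i j /\ \sum_k b i k * N k j = r i * b i j,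
      forall i j, \sum_k (a i k * a j k + b i k * b j k) = (i == j)%:R
    & forall i j, \sum_k (b i k * a j k - a i k * b j k) = 0].
Proof.
move=> Nsym; pose rc := real_complex R; pose NC := map_mx rc N.
have hermN : NC \is hermsymmx.
  apply: realsym_hermsym.
    apply/is_hermitianmxP; rewrite expr0 scale1r map_mx_id // /NC map_trmx.
    by rewrite Nsym.
  by apply/mxOverP => i j; rewrite mxE; apply/complex_realP; exists (N i j).
have /orthomx_spectralP NE := hermitian_normalmx hermN.
have /mxOverP dreal := hermitian_spectral_diag_real hermN.
have Uu := spectral_unit NC; have /unitarymxP Uo := spectral_unitarymx NC.
set U := spectralmx NC in NE Uu Uo; set dg := spectral_diag NC in NE dreal.
pose r i := complex.Re (dg 0 i).
have rE i : dg 0 i = (r i)%:C by rewrite /r RRe_real // dreal.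
have UN i j : \sum_k U i k * (N k j)%:C = (r i)%:C * U i j.
  have : U *m NC = diag_mx dg *m U by rewrite {1}NE !mulmxA mulmxV // mul1mx.
  move/matrixP/(_ i j); rewrite !mxE => e.
  transitivity (\sum_k U i k * NC k j); first by apply: eq_bigr => k _; rewrite mxE.
  rewrite e (bigD1 i) //= big1 => [|k /negPf ki]; last by rewrite mxE eq_sym ki mulr0n mul0r.
  by rewrite !mxE eqxx mulr1n addr0 rE.
have Uorth i j : \sum_k U i k * (U j k)^* = (i == j)%:R.
  have := congr1 (fun M : 'M_n => M i j) Uo; rewrite !mxE => <-.
  by apply: eq_bigr => k _; rewrite !mxE.
have ReS (F : 'I_n -> R[i]) : complex.Re (\sum_k F k) = \sum_k complex.Re (F k).
  by elim/big_rec2: _ => // k y1 y2 _ <-; case: (F k); case: y2.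
have ImS (F : 'I_n -> R[i]) : complex.Im (\sum_k F k) = \sum_k complex.Im (F k).
  by elim/big_rec2: _ => // k y1 y2 _ <-; case: (F k); case: y2.
exists r, (fun i k => complex.Re (U i k)), (fun i k => complex.Im (U i k)); split.
- apply: (map_inj_poly (f := rc)); first exact: complexI.
    by [].
  rewrite map_char_poly -/NC (char_poly_conj Uu NE) char_poly_trig; last first.
    by apply/is_trig_mxP => i j ij; rewrite mxE -val_eqE /= (ltn_eqF ij).
  rewrite rmorph_prod /=; apply: eq_bigr => i _.
  by rewrite mxE eqxx mulr1n rE rmorphB /= map_polyX map_polyC.
- move=> i j; have e := UN i j; split.
    have := congr1 (@complex.Re R) e; rewrite ReS => h.
    transitivity (\sum_k complex.Re (U i k * (N k j)%:C)).
      by apply: eq_bigr => k _; case: (U i k) => x y /=; rewrite mulr0 subr0.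
    by rewrite h; case: (U i j) => x y /=; rewrite mul0r subr0.
  have := congr1 (@complex.Im R) e; rewrite ImS => h.
  transitivity (\sum_k complex.Im (U i k * (N k j)%:C)).
    by apply: eq_bigr => k _; case: (U i k) => x y /=; rewrite mulr0 add0r.
  by rewrite h; case: (U i j) => x y /=; rewrite mul0r addr0.
- move=> i j; have := congr1 (@complex.Re R) (Uorth i j); rewrite ReS.
  have -> : complex.Re ((i == j)%:R : R[i]) = (i == j)%:R by case: eqP.
  move=> <-; apply: eq_bigr => k _.
  by case: (U i k) => x y; case: (U j k) => z t /=; rewrite mulrN opprK.
move=> i j; have := congr1 (@complex.Im R) (Uorth i j); rewrite ImS.
have -> : complex.Im ((i == j)%:R : R[i]) = 0 by case: eqP.
move=> h; rewrite -[RHS]h; apply: eq_bigr => k _.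
by case: (U i k) => x y; case: (U j k) => z t /=; rewrite mulrN addrC.
Qed.

End SymmetricSpectrum.

(** * From a quadratic form inequality to the spectral gap *)

Section ReversibleGap.
Context (R : rcfType) (n : nat) (M : 'M[R]_n) (m : 'I_n -> R) (dl : R).
Context (m_gt0 : forall i, 0 < m i) (balance : forall i j, m i * M i j = m j * M j i).
Context (M1 : forall i, \sum_j M i j = 1) (dl01 : 0 < dl <= 1).

Let app (g : 'I_n -> R) i := \sum_j M i j * g j.

Context (psd : forall g, 0 <= \sum_i m i * (g i * app g i)).
Context (gap : forall g, \sum_i m i * g i = 0 ->
  \sum_i m i * (g i * app g i) <= (1 - dl) * \sum_i m i * (g i * g i)).

(** Stationarity makes the mean of [g] equal to r times itself, so r != 1 forces mean zero and [gap]
    applies. If r = 1, [gap] applied to [g] minus its mean shows that this difference vanishes. *)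
Lemma eigenfunction_cases (g : 'I_n -> R) r : (forall i, app g i = r * g i) ->
  (forall i, g i = 0) \/ (0 <= r <= 1 - dl) \/ (r = 1 /\ exists c, forall i, g i = c).
Proof.
move=> eg; have /andP[dl0 dl1] := dl01.
have sq0 (k : 'I_n -> R) j : 0 <= m j * (k j * k j).
  by apply: mulr_ge0; [exact: ltW|rewrite -expr2 sqr_ge0].
have qz (k : 'I_n -> R) : \sum_i m i * (k i * k i) <= 0 -> forall i, k i = 0.
  move=> k0 i; apply/eqP; have : \sum_i m i * (k i * k i) == 0.
    by rewrite eq_le k0 sumr_ge0.
  rewrite psumr_eq0 // => /allP/(_ i (mem_index_enum _)).
  by rewrite !mulf_eq0 (gt_eqF (m_gt0 i)) orbb.
have form (k : 'I_n -> R) s : (forall i, app k i = s * k i) ->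
    \sum_i m i * (k i * app k i) = s * \sum_i m i * (k i * k i).
  by move=> ek; rewrite mulr_sumr; apply: eq_bigr => i _; rewrite ek; ring.
have [q0|q0] := leP (\sum_i m i * (g i * g i)) 0; first by left; apply: qz.
right; have r0 : 0 <= r by have := psd g; rewrite (form g r eg) pmulr_lge0.
have mean : \sum_i m i * g i = r * \sum_i m i * g i.
  rewrite mulr_sumr; transitivity (\sum_i m i * app g i); last first.
    by apply: eq_bigr => i _; rewrite eg mulrCA.
  under [RHS]eq_bigr => i _ do rewrite mulr_sumr.
  rewrite exchange_big; apply: eq_bigr => j _.
  rewrite (eq_bigr (fun i => m j * g j * M j i)) => [|i _].
    by rewrite -mulr_sumr M1 mulr1.
  by rewrite mulrA balance; ring.
have [r1|r1] := eqVneq r 1; [right|left]; last first.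
  have m0 : \sum_i m i * g i = 0.
    apply/eqP; have : (1 - r) * \sum_i m i * g i = 0 by rewrite mulrBl mul1r -mean subrr.
    by move/eqP; rewrite mulf_eq0 subr_eq0 eq_sym (negPf r1).
  by rewrite r0; have := gap m0; rewrite (form g r eg) ler_pM2r.
split=> //; set Z := \sum_i m i.
have [Z0|Z0] := leP Z 0.
  exists 0 => i; exfalso; move: Z0; apply/negP; rewrite -ltNge /Z (bigD1 i) //=.
  by rewrite ltr_wpDr // sumr_ge0 // => j _; apply: ltW.
pose c := (\sum_i m i * g i) / Z; exists c => i; apply/eqP; rewrite -subr_eq0; apply/eqP.
pose k j := g j - c; apply: (qz k).
have ek j : app k j = 1 * k j.
  rewrite /k mul1r /app; under eq_bigr => l _ do rewrite mulrBr.
  by rewrite sumrB -mulr_suml M1 mul1r -[X in X - _]/(app g j) eg r1 mul1r.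
have mk : \sum_j m j * k j = 0.
  rewrite /k; under eq_bigr => l _ do rewrite mulrBr.
  by rewrite sumrB -mulr_suml -/Z /c mulrC divfK ?gt_eqF // subrr.
have := gap mk; rewrite (form k 1 ek) mul1r mulrBl mul1r.
by rewrite -(pmulr_rle0 _ dl0) => h; lra.
Qed.

(** Conjugation by the square roots [w] of the masses makes [M] symmetric. Its eigenvalues lie in
    [0, 1 - dl] or equal 1, and 1 is simple: its eigenvectors are multiples of [w], and two of them
    cannot be orthogonal. *)
Lemma reversible_spectral_gap : spectral_gap_ge M dl.
Proof.
have /andP[dl0 dl1] := dl01.
pose w i := Num.sqrt (m i).
have w0 i : w i != 0 by rewrite gt_eqF // sqrtr_gt0.
have ww i : w i * w i = m i by rewrite -expr2 sqr_sqrtr // ltW.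
pose N := \matrix_(i, j) (w i * M i j / w j).
have Nsym : N^T = N.
  apply/matrixP => i j; rewrite !mxE.
  have := balance i j; rewrite -!ww => e.
  apply: (mulfI (w0 i)); apply: (mulfI (w0 j)).
  transitivity (w j * w j * M j i); first by field.
  by rewrite -e; field.
have [r [a [b [chN eig orth1 orth2]]]] := symmetric_spectrum Nsym.
have chM : char_poly M = \prod_i ('X - (r i)%:P).
  rewrite -chN; pose D := diag_mx (\row_i w i).
  have Du : D \in unitmx.
    by rewrite unitmxE det_diag unitfE; apply/prodf_neq0 => i _; rewrite mxE.
  apply: (char_poly_conj Du); rewrite -mulmxA; apply: (canRL (mulKmx Du)).
  apply/matrixP => i j; rewrite !mxE (bigD1 i) //= big1 => [|k /negPf ki]; last first.
    by rewrite !mxE eq_sym ki mulr0n mul0r.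
  rewrite (bigD1 j) //= big1 => [|k /negPf kj]; last by rewrite !mxE kj mulr0n mulr0.
  by rewrite !mxE !eqxx !mulr1n !addr0 divfK.
have eigfun (v : 'I_n -> R) s : (forall j, \sum_k v k * N k j = s * v j) ->
    forall i, app (fun k => v k / w k) i = s * (v i / w i).
  move=> e i; rewrite mulrA -e /app mulr_suml; apply: eq_bigr => j _.
  have -> : N j i = N i j by rewrite -{1}Nsym mxE.
  by rewrite mxE; field; rewrite !w0.
have cases i : 0 <= r i <= 1 - dl \/
    (r i = 1 /\ exists al be, forall k, a i k = al * w k /\ b i k = be * w k).
  have ea := eigenfunction_cases (eigfun (a i) (r i) (fun j => (eig i j).1)).
  have eb := eigenfunction_cases (eigfun (b i) (r i) (fun j => (eig i j).2)).
  have conv (v : 'I_n -> R) c : (forall k, v k / w k = c) -> forall k, v k = c * w k.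
    by move=> H k; rewrite -(H k) divfK.
  case: ea => [az|[h|[r1 [al aE]]]]; [|by left|].
    case: eb => [bz|[h|[r1 [be bE]]]]; [|by left|].
      exfalso; have := orth1 i i; rewrite eqxx big1 => [/esym/eqP|k _].
        by rewrite oner_eq0.
      by rewrite (conv _ _ az) (conv _ _ bz) !mul0r addr0.
    by right; split=> //; exists 0, be => k; rewrite (conv _ _ az) (conv _ _ bE).
  case: eb => [bz|[h|[_ [be bE]]]]; [|by left|].
    by right; split=> //; exists al, 0 => k; rewrite (conv _ _ aE) (conv _ _ bz).
  by right; split=> //; exists al, be => k; rewrite (conv _ _ aE) (conv _ _ bE).
have uniq1 i j : r i = 1 -> r j = 1 -> i = j.
  have ne : 1 - dl < 1 by rewrite ltrBlDr ltrDl.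
  have get k : r k = 1 -> exists al be, forall l, a k l = al * w l /\ b k l = be * w l.
    by move=> rk; case: (cases k) => [|[]//]; rewrite rk => /andP[_]; rewrite leNgt ne.
  move=> /get[ai [bi ei]] /get[aj [bj ej]]; apply/eqP/negPn/negP => /negPf ij.
  pose W := \sum_k w k * w k.
  have o1 k l (al be al' be' : R) : (forall t, a k t = al * w t /\ b k t = be * w t) ->
      (forall t, a l t = al' * w t /\ b l t = be' * w t) ->
      (al * al' + be * be') * W = (k == l)%:R /\ (be * al' - al * be') * W = 0.
    move=> ek el; split; [rewrite -[RHS]orth1|rewrite -[RHS](orth2 k l)]; rewrite /W mulr_sumr;
    by apply: eq_bigr => t _; rewrite (ek t).1 (ek t).2 (el t).1 (el t).2; ring.
  have [h1 h2] := o1 i j _ _ _ _ ei ej; rewrite ij in h1.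
  have [h3 _] := o1 i i _ _ _ _ ei ei; have [h4 _] := o1 j j _ _ _ _ ej ej.
  rewrite eqxx in h3.
  (* Multiplicativity of the complex modulus; orthonormality would make the left side 1 and the
     right side 0. *)
  have : ((ai * ai + bi * bi) * W) * ((aj * aj + bj * bj) * W) =
     ((ai * aj + bi * bj) * W) ^+ 2 + ((bi * aj - ai * bj) * W) ^+ 2 by ring.
  by rewrite h1 h2 h3 h4 eqxx !expr0n /= mulr1 addr0 => /eqP; rewrite oner_eq0.
pose s := sort (fun x y : R => y <= x) [seq r i | i <- enum 'I_n].
have s_sorted : sorted (fun x y : R => y <= x) s.
  by apply: sort_sorted => x y; apply: le_total.
have s_perm : perm_eq s [seq r i | i <- enum 'I_n] by rewrite perm_sort.
exists s; split=> //.
  by rewrite chM (perm_big _ s_perm) big_map big_enum.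
have s_mem x : x \in s -> exists i, x = r i.
  by rewrite (perm_mem s_perm) => /mapP[i _ ->]; exists i.
have count1 : (count_mem (1%R : R) s <= 1)%N.
  rewrite (permP s_perm) count_map -size_filter.
  set l := filter _ _; case lE : l => [|i [|j l']] //.
  have ul : uniq l by apply/filter_uniq/enum_uniq.
  have li : i \in l by rewrite lE mem_head.
  have lj : j \in l by rewrite lE !inE eqxx orbT.
  move: li lj; rewrite !mem_filter /= => /andP[/eqP ri _] /andP[/eqP rj _].
  by move: ul; rewrite lE (uniq1 i j ri rj) /= mem_head.
rewrite /gap_of_spectrum lerBrDr -lerBrDl.
have bnd x : x \in behead s -> `|x| <= 1 - dl.
  case sE : s s_sorted s_mem count1 => [//|x0 s'] /= srt smem cnt xs.
  have [i xi] := smem x (mem_behead (s := x0 :: s') xs).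
  case: (cases i) => [/andP[ri0 ri1]|[ri1 _]]; first by rewrite xi ger0_norm.
  (* A 1 in the tail of the decreasing list forces the head to be 1 as well, against simplicity. *)
  have x1 : x = 1 by rewrite xi.
  have x0x : x <= x0.
    have tr : transitive (fun x y : R => y <= x) by move=> y z t h1 h2; apply: le_trans h2 h1.
    by have /allP/(_ x xs) := order_path_min tr srt.
  have [j xj] := smem x0 (mem_head _ _).
  have x01 : x0 = 1.
    apply/eqP; rewrite eq_le -{2}x1 x0x andbT xj.
    by case: (cases j) => [/andP[_ rj]|[-> _]//]; apply: le_trans rj _; rewrite gerBl ltW.
  have : (0 < count_mem (1%R : R) s')%N by rewrite -has_count has_pred1 -x1.
  by move: cnt; rewrite x01 eqxx add1n ltnS leqn0 => /eqP ->.
rewrite big_seq; elim/big_rec: _ => [|x y xs IH]; first by rewrite subr_ge0.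
by rewrite ge_max bnd.
Qed.

End ReversibleGap.

(** * The block dynamics as an average of projections *)

Section ConditionalExpectation.
Context (R : archiRealFieldType) (T S : finType) (mu : {ffun T -> S} -> R).
Context (A : {set T}).
Local Notation Z sigma := (\sum_(rho | agree_off A sigma rho) mu rho).

Lemma agree_offC (sigma tau : {ffun T -> S}) : agree_off A sigma tau = agree_off A tau sigma.
Proof. by apply/agree_offP/agree_offP => H x /H. Qed.

Lemma agree_mass (sigma tau : {ffun T -> S}) : agree_off A sigma tau -> Z sigma = Z tau.
Proof. by move=> e; apply: eq_bigl; apply: eq_agree_off. Qed.

(** Agreement off [A] is symmetric and the fibre mass is constant on fibres, so the double sum
    expressing the inner product is symmetric. *)
Lemma cond_exp_projection : projection mu (cond_exp mu A).
Proof.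
split=> [a f g|f|f g].
- apply/ffunP => s; rewrite !ffunE; transitivity (a * ((\sum_(t | agree_off A s t) mu t * f t) / Z s) +
    (\sum_(t | agree_off A s t) mu t * g t) / Z s); last by [].
  rewrite mulrA -mulrDl; congr (_ / _); rewrite mulr_sumr -big_split.
  apply: eq_bigr => t _; rewrite !ffunE /= mulrDr; congr (_ + _); exact: mulrCA.
- apply/ffunP => s; rewrite ffunE.
  rewrite (eq_bigr (fun t => mu t * cond_exp mu A f s)) => [|t st]; last first.
    by rewrite (cond_exp_local mu f st).
  rewrite -mulr_suml; have [Z0|Z0] := eqVneq (Z s) 0; last by rewrite mulrAC mulfV // mul1r.
  by rewrite Z0 mul0r ffunE Z0 invr0 !mulr0.
pose F (s t : {ffun T -> S}) := if agree_off A s t then mu s * mu t * f t * g s / Z s else 0.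
transitivity (\sum_s \sum_t F s t).
  apply: eq_bigr => s _; rewrite ffunE /F -big_mkcond /= !mulr_suml mulr_sumr.
  by apply: eq_bigr => t _; ring.
rewrite exchange_big; apply: eq_bigr => t _; rewrite ffunE /F.
rewrite (eq_bigr (fun s => if agree_off A t s then mu s * mu t * f t * g s / Z s else 0)) => [|s _].
  rewrite -big_mkcond /= mulr_suml !mulr_sumr; apply: eq_bigr => s ts.
  by rewrite (agree_mass ts); ring.
by rewrite agree_offC.
Qed.

End ConditionalExpectation.

Section BlockMatrix.
Context (R : archiRealFieldType) (d : nat) (S : finType) (Ue : S -> S -> R) (Wv : S -> R).
Context (Ue_ge0 : forall s t, 0 <= Ue s t) (Wv_gt0 : forall s, 0 < Wv s).
Context (T : finType) (pos : T -> site d) (psi : site d -> option S) (r : nat) (A : 'I_r -> {set T}).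
Local Notation mu := (gibbs Ue Wv pos psi).
Local Notation M := (block_matrix Ue Wv pos psi A).
Local Notation state := {sigma : {ffun T -> S} | valid_cfg Ue Wv pos psi sigma}.
Local Notation cfg i := (val (enum_val i : state)).

Let mu_ge0 s : 0 <= mu s. Proof. exact: gibbs_ge0. Qed.

(** Invalid configurations have mass zero, so matrix sums over valid states become sums over all
    configurations. *)
Lemma sum_states (F : {ffun T -> S} -> R) :
  \sum_(i < #|{: state}|) mu (cfg i) * F (cfg i) = \sum_s mu s * F s.
Proof.
rewrite -(big_enum_val (A := {: state}) (fun x : state => mu (val x) * F (val x))) /=.
rewrite (eq_bigl predT) // -(big_codom _ predT (fun s => mu s * F s) val_inj).
rewrite big_mkcond /=; apply: eq_bigr => s _; rewrite andbT; case: ifPn => // ns.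
have [->|mus] := eqVneq (mu s) 0; first by rewrite mul0r.
case/codomP: ns; have vs : valid_cfg Ue Wv pos psi s by rewrite /valid_cfg lt_def mus mu_ge0.
by exists (exist _ s vs).
Qed.

Lemma block_matrix_entry i j : M i j = r%:R^-1 * \sum_k
  (if agree_off (A k) (cfg i) (cfg j) then
     mu (cfg j) / \sum_(rho | agree_off (A k) (cfg i) rho) mu rho else 0).
Proof. by rewrite mxE /block_kernel card_ord. Qed.

Lemma block_matrix_action i (f : {ffun {ffun T -> S} -> R^o}) :
  \sum_j M i j * f (cfg j) = r%:R^-1 * \sum_k cond_exp mu (A k) f (cfg i).
Proof.
under eq_bigr => j _ do rewrite block_matrix_entry -mulrA mulr_suml.
rewrite -mulr_sumr; congr (_ * _); rewrite exchange_big; apply: eq_bigr => k _.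
rewrite ffunE; set Z := \sum_(_ | _) mu _.
rewrite (eq_bigr (fun j => mu (cfg j) *
  (if agree_off (A k) (cfg i) (cfg j) then f (cfg j) / Z else 0))) => [|j _]; last first.
  by case: ifP => _; [ring|rewrite mulr0 mul0r].
rewrite (sum_states (fun s => if agree_off (A k) (cfg i) s then f s / Z else 0)).
rewrite mulr_suml [RHS]big_mkcond /=; apply: eq_bigr => s _.
by case: ifP => _; [rewrite mulrA|rewrite mulr0].
Qed.

Lemma agree_mass_gt0 k (i : 'I_#|{: state}|) :
  0 < \sum_(rho | agree_off (A k) (cfg i) rho) mu rho.
Proof.
rewrite (bigD1 (cfg i)) /=; last by apply/agree_offP.
by apply: ltr_wpDr; [apply: sumr_ge0|exact: (valP (enum_val i))].
Qed.

Lemma block_matrix_stochastic i : (0 < r)%N -> \sum_j M i j = 1.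
Proof.
move=> r0; transitivity (\sum_j M i j * (finfun (fun=> 1) : {ffun {ffun T -> S} -> R^o}) (cfg j)).
  by apply: eq_bigr => j _; rewrite ffunE mulr1.
rewrite block_matrix_action (eq_bigr (fun=> 1)) => [|k _].
  by rewrite sumr_const card_ord mulVf // pnatr_eq0 -lt0n.
rewrite ffunE; under eq_bigr => s _ do rewrite ffunE mulr1.
by rewrite mulfV // gt_eqF // agree_mass_gt0.
Qed.

Lemma block_matrix_balance i j : mu (cfg i) * M i j = mu (cfg j) * M j i.
Proof.
rewrite !block_matrix_entry mulrCA [RHS]mulrCA !mulr_sumr; apply: eq_bigr => k _.
rewrite [agree_off _ (cfg j) (cfg i)]agree_offC; case: ifP => [e|_]; last by rewrite !mulr0.
by rewrite (agree_mass mu e); ring.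
Qed.

Definition extend_state (g : 'I_#|{: state}| -> R) : {ffun {ffun T -> S} -> R^o} :=
  [ffun s => if insub s is Some x then g (enum_rank (x : state)) else 0].

Lemma extend_stateE g i : extend_state g (cfg i) = g i.
Proof. by rewrite ffunE valK enum_valK. Qed.

(** The form of the block matrix is the average of the forms of the projections; positivity and the
    gap are both read off from it. *)
Lemma block_matrix_form (g : 'I_#|{: state}| -> R) :
  \sum_i mu (cfg i) * (g i * \sum_j M i j * g j) =
  r%:R^-1 * \sum_k dot mu (extend_state g) (cond_exp mu (A k) (extend_state g)).
Proof.
set f := extend_state g.
pose F s := (f s : R) * (r%:R^-1 * \sum_k cond_exp mu (A k) f s).
rewrite (eq_bigr (fun i => mu (cfg i) * F (cfg i))) => [|i _].
  rewrite (sum_states F) /dot exchange_big mulr_sumr; apply: eq_bigr => s _.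
  by rewrite /F -!mulr_sumr; ring.
rewrite /F -block_matrix_action /f extend_stateE; congr (_ * (_ * _)).
by apply: eq_bigr => j _; rewrite extend_stateE.
Qed.

End BlockMatrix.

(** * The relaxation time of the block dynamics *)

Theorem theorem2 (R : archiRcfType) (d : nat) (S : finType)
    (Ue : S -> S -> R) (Wv : S -> R) :
  (0 < d)%N ->
  (forall s t, 0 <= Ue s t) ->
  (forall s t, Ue s t = Ue t s) ->
  (forall s, 0 < Wv s) ->
  permissive d Ue Wv ->
  glauber_irreducible d Ue Wv ->
  SSM d Ue Wv ->
  exists2 c : R, 0 < c &
    forall (a : site d) (L : nat) (psi : site d -> option S)
           (r : nat) (A : 'I_r -> {set cube d L}),
      (0 < L)%N ->
      \bigcup_(i < r) A i = [set: cube d L] ->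
      spectral_gap_ge (block_matrix Ue Wv (cube_pos (L:=L) a) psi A) (c / r%:R).
Proof.
move=> d0 Ue_ge0 Ue_sym Wv_gt0 perm irred ssm.
have [C C0 gap] := block_gap Ue_ge0 Ue_sym Wv_gt0 perm irred ssm d0.
(* Taking 1 + C instead of C ensures c / r <= 1, as [reversible_spectral_gap] demands. *)
exists (1 + C)^-1 => [|a L psi r A L0 cov]; first by rewrite invr_gt0 addr_gt0.
pose mu := gibbs Ue Wv (cube_pos (L := L) a) psi.
have mu0 s : 0 <= mu s by apply: gibbs_ge0.
have r0 : (0 < r)%N.
  case: r A cov => // A; rewrite big_ord0 => /setP/(_ [ffun=> Ordinal L0]).
  by rewrite !inE.
have rR : (0 : R) < r%:R by rewrite ltr0n.
have pE k := cond_exp_projection mu (A k).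
apply: (reversible_spectral_gap (m := fun i => mu (val (enum_val i)))).
- by move=> i; apply: (valP (enum_val i)).
- by move=> i j; apply: block_matrix_balance.
- by move=> i; apply: block_matrix_stochastic.
- rewrite divr_gt0 ?invr_gt0 ?addr_gt0 //= ler_pdivrMr // mul1r.
  apply: (@le_trans _ _ 1); last by rewrite ler1n.
  by rewrite invf_le1 ?addr_gt0 // lerDl ltW.
- move=> g; rewrite block_matrix_form // mulr_ge0 ?invr_ge0 // sumr_ge0 // => k _.
  by rewrite (projection_dot (pE k)) sqnorm_ge0.
move=> g g0; rewrite block_matrix_form //; set f := extend_state g.
have f0 : dot mu f (finfun (fun=> 1)) = 0.
  rewrite /dot -(sum_states Ue_ge0 Wv_gt0) -[RHS]g0; apply: eq_bigr => i _.
  by rewrite extend_stateE ffunE mulr1.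
have -> : \sum_i mu (val (enum_val i)) * (g i * g i) = sqnorm mu f.
  rewrite /sqnorm /dot -(sum_states Ue_ge0 Wv_gt0); apply: eq_bigr => i _.
  by rewrite extend_stateE.
(* By Pythagoras [block_gap] reads s <= C (r s - t), with s = |f|^2 and t the sum of the forms of
   the projections. *)
have := gap a L psi r A f cov f0; rewrite -/mu.
under eq_bigr => k _ do rewrite (projection_pythagoras (pE k)) -(projection_dot (pE k)).
rewrite sumrB sumr_const card_ord -(mulr_natl (sqnorm mu f)); set t := \sum_k _; set s := sqnorm mu f => h.
have s0 : 0 <= s by apply: sqnorm_ge0.
rewrite mulrC ler_pdivrMr //.
have -> : (1 - (1 + C)^-1 / r%:R) * s * r%:R = r%:R * s - (1 + C)^-1 * s.
  by field; rewrite !gt_eqF // addr_gt0.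
have h2 : (1 + C)^-1 * s <= C^-1 * s.
  by rewrite ler_wpM2r // lef_pV2 ?posrE ?addr_gt0 // lerDr.
have h3 : C^-1 * s <= r%:R * s - t by rewrite mulrC ler_pdivrMr // mulrC.
lra.
Qed.
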